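(* For all $\lambda_1,\lambda_2\in[0,1]$ and all $\Phi\in\mathbb T$, the direct integral operators $\int_{\mathbb T}^\oplus W_{\lambda_1,\lambda_2,\Phi,\theta}\,d\theta$ and $\int_{\mathbb T}^\oplus W^\sharp_{\lambda_1,\lambda_2,\Phi,\theta}\,d\theta$ are unitarily equivalent as operators on $\int_{\mathbb T}^\oplus\mathscr H_1\,d\theta$.
   Context: Let $\mathbb T=\mathbb R/\mathbb Z$. Let $\mathscr H_1=\ell^2(\mathbb Z)\otimes\mathbb C^2$ with orthonormal basis $\delta_n^{s}=\delta_n\otimes e_s$ ($n\in\mathbb Z$, $s\in\{+,-\}$), $e_+=(1,0)^\top$, $e_-=(0,1)^\top$; write $\psi_n^s=\langle\delta_n^s,\psi\rangle$ and $\psi_n=(\psi_n^+,\psi_n^-)^\top$. For $\lambda\in[0,1]$ put $\lambda'=\sqrt{1-\lambda^2}$ and let $S_\lambda$ be the unitary operator with $S_\lambda\delta_n^\pm=\lambda\delta_{n\pm1}^\pm\pm\lambda'\delta_n^\mp$. For $\lambda_2\in[0,1]$, $\Phi,\theta\in\mathbb T$, $n\in\mathbb Z$ let $$Q_n=Q_{\lambda_2,\Phi,\theta,n}=\begin{bmatrix}\lambda_2\cos(2\pi(n\Phi+\theta))+i\lambda_2' & -\lambda_2\sin(2\pi(n\Phi+\theta))\\ \lambda_2\sin(2\pi(n\Phi+\theta)) & \lambda_2\cos(2\pi(n\Phi+\theta))-i\lambda_2'\end{bmatrix},$$ and let $Q_{\lambda_2,\Phi,\theta}$ act by $(Q\psi)_n=Q_n\psi_n$.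 The unitary almost-Mathieu operator is $W_{\lambda_1,\lambda_2,\Phi,\theta}=S_{\lambda_1}Q_{\lambda_2,\Phi,\theta}$ on $\mathscr H_1$, for $\lambda_1,\lambda_2\in[0,1]$. Transposes are taken with respect to the basis $\{\delta_n^s\}$, and $W^\sharp_{\lambda_1,\lambda_2,\Phi,\theta}:=W^\top_{\lambda_2,\lambda_1,\Phi,\theta}$. *)

(* Defs.v *)
From HB Require Import structures.
From mathcomp Require Import all_boot all_order all_algebra.
From mathcomp Require Import complex.
From mathcomp Require Import all_classical all_reals all_analysis.

Set Implicit Arguments.
Unset Strict Implicit.
Unset Printing Implicit Defensive.

Import Order.TTheory GRing.Theory Num.Theory.
Local Open Scope classical_set_scope.
Local Open Scope ring_scope.

Section UAMO.
Variable R : realType.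
Local Notation C := R[i].

(* A vector of l^2(Z) (x) C^2 is represented by its coordinates psi n s,
   with s = true for "+" and s = false for "-". *)
Definition vec := int -> bool -> C.

Definition lamp (l : R) : R := Num.sqrt (1 - l ^+ 2).

Definition Qentry (l2 Phi th : R) (n : int) (s t : bool) : C :=
  let a := 2 * pi * (n%:~R * Phi + th) in
  match s, t with
  | true, true => Complex (l2 * cos a) (lamp l2)
  | true, false => Complex (- (l2 * sin a)) 0
  | false, true => Complex (l2 * sin a) 0
  | false, false => Complex (l2 * cos a) (- lamp l2)
  end.

Definition delta (n : int) (t : bool) : vec :=
  fun m s => if (m == n) && (s == t) then 1 else 0.

Definition Sdelta (l : R) (n : int) (t : bool) : vec :=
  fun m s =>
    if t then (l%:C)%C * delta (n + 1) true m s + ((lamp l)%:C)%C * delta n false m s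
    else (l%:C)%C * delta (n - 1) false m s - ((lamp l)%:C)%C * delta n true m s.

(* W delta_n^t = S_{l1} (Q delta_n^t) = sum_u Q_n[u,t] S_{l1} delta_n^u *)
Definition Wdelta (l1 l2 Phi th : R) (n : int) (t : bool) : vec :=
  fun m s => \sum_(u : bool) Qentry l2 Phi th n u t * Sdelta l1 n u m s.

Definition Wmat (l1 l2 Phi th : R) : int -> bool -> int -> bool -> C :=
  fun m s n t => Wdelta l1 l2 Phi th n t m s.

Definition Wsharp_mat (l1 l2 Phi th : R) : int -> bool -> int -> bool -> C :=
  fun m s n t => Wmat l2 l1 Phi th n t m s.

(* Action of a matrix K whose entries K m s n t vanish for |n - m| > 1
   (true for W and W^sharp):  (K psi)_m^s = sum_{n,t} K m s n t psi_n^t. *)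
Definition band_apply (K : int -> bool -> int -> bool -> C) (psi : vec) : vec :=
  fun m s => \sum_(d < 3) \sum_(t : bool)
     K m s (m + d%:Z - 1) t * psi (m + d%:Z - 1) t.

(* Elements of the direct integral  \int^+_T H_1 d theta  are represented by
   fields F : R -> vec (theta in T = [0,1] mod 1), modulo a.e. equality. *)
Definition field := R -> vec.

Definition sqnormC (z : C) : R := let: Complex a b := z in a ^+ 2 + b ^+ 2.

Definition L2norm2 (F : field) : \bar R :=
  (\int[lebesgue_measure]_(th in `[0%R, 1%R]%classic)
     \esum_(k in [set: int * bool]) (sqnormC (F th k.1 k.2))%:E)%E.

Definition in_L2 (F : field) : Prop :=
  (forall n s, measurable_fun setT (fun th => complex.Re (F th n s)) /\
               measurable_fun setT (fun th => complex.Im (F th n s))) /\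
  (L2norm2 F < +oo)%E.

Definition ae_eq (F G : field) : Prop :=
  lebesgue_measure.-negligible [set th : R | 0 <= th <= 1 /\ F th <> G th].

Definition dirint (K : R -> int -> bool -> int -> bool -> C) : field -> field :=
  fun F th => band_apply (K th) (F th).

(* A, B (operators on the direct integral, acting on representatives) are
   unitarily equivalent: there is a unitary U of the L^2 space (a linear,
   norm-preserving, surjective map on a.e.-classes) with U A = B U. *)
Definition unitarily_equivalent (A B : field -> field) : Prop :=
  exists U : field -> field,
    [/\ (forall F, in_L2 F -> in_L2 (U F)) /\
         (forall F G, in_L2 F -> in_L2 G -> ae_eq F G -> ae_eq (U F) (U G)),
        forall (a : C) F G, in_L2 F -> in_L2 G ->
          ae_eq (U (fun th n s => a * F th n s + G th n s))
                (fun th n s => a * U F th n s + U G th n s),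
        forall F, in_L2 F -> L2norm2 (U F) = L2norm2 F,
        forall G, in_L2 G -> exists2 F, in_L2 F & ae_eq (U F) G
      & forall F, in_L2 F -> ae_eq (U (A F)) (B (U F))].

End UAMO.

(* Main.v *)
(** Aubry duality.  Expand the fiber component at site [n] of a field in the
    Fourier basis [exp (2 pi i m th)].  With [z] the shift of sites and [w] the
    multiplication by [exp (2 pi i (n Phi + th))] one has
    [w z = exp (2 pi i Phi) z w], and the permutation of the Fourier basis
    [(m, n) |-> (n, - m)], twisted by the phase [exp (- 2 pi i m n Phi)],
    implements [z |-> w], [w |-> z^-1].  Conjugation by the constant matrix
    [M = 2^(-1/2) [[1, -i], [-i, 1]]] diagonalises the rotations inside [Q] and
    turns [S_{l1}(z) Q_{l2}(w)] into [Q_{l1}(z)^T S_{l2}(w^-1)^T], which is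
    [W^sharp] after the exchange.  Unitarity of the map on coefficients becomes
    unitarity on fields through Parseval and Riesz-Fischer.

    Completeness of the trigonometric system: a function [u] orthogonal to all
    [cos (2 pi m x)] and [sin (2 pi m x)] is orthogonal to
    [(1 - y^n)^(2^n)] for every trigonometric polynomial [y] with values in
    [[0, 1]]; these tend boundedly to the indicator of [y < 1/2].  Choosing [y]
    so that [y < 1/2] is [0 < x < b] gives [\int_0^b u = 0] for all [b], and
    Lebesgue differentiation concludes. *)

Require Import Defs.
From HB Require Import structures.
From mathcomp Require Import all_boot all_order all_algebra.
From mathcomp Require Import complex.
From mathcomp Require Import all_classical all_reals all_analysis.
From mathcomp Require Import measurable_realfun ring lra zify.
Set Implicit Arguments.
Unset Strict Implicit.
Unset Printing Implicit Defensive.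
Import Order.TTheory GRing.Theory Num.Theory.
Import numFieldNormedType.Exports.
Local Open Scope classical_set_scope.
Local Open Scope ring_scope.

(** * Completeness of the trigonometric system *)

Section TrigonometricSystem.
Context {R : realType}.
Local Notation mu := (@lebesgue_measure R).
Local Notation I01 := (`[0%R, 1%R]%classic : set R).
Implicit Types u v h : R -> R.

Definition int01 u : Prop := mu.-integrable I01 (EFin \o u).

Lemma int01D u v : int01 u -> int01 v -> int01 (fun x => u x + v x).
Proof. by move=> iu iv; exact: (integrableD _ iu iv). Qed.

Lemma int01Z (a : R) u : int01 u -> int01 (fun x => a * u x).
Proof. by move=> iu; exact: (integrableZl _ a iu). Qed.

Lemma Rint01D u v : int01 u -> int01 v ->
  \int[mu]_(x in I01) (u x + v x) = \int[mu]_(x in I01) u x + \int[mu]_(x in I01) v x.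
Proof. by move=> iu iv; apply: RintegralD. Qed.

Lemma Rint01Z (a : R) u : int01 u ->
  \int[mu]_(x in I01) (a * u x) = a * \int[mu]_(x in I01) u x.
Proof. by move=> iu; apply: RintegralZl. Qed.

Lemma int01M_bounded u h (M : R) : int01 u -> measurable_fun setT h ->
  (forall x, `|h x| <= M) -> int01 (fun x => u x * h x).
Proof.
move=> iu mh hM.
have mu01 : measurable_fun I01 u by apply/measurable_EFinP; exact: measurable_int iu.
apply: (@le_integrable _ _ _ mu _ _ _ (fun x => (M * u x)%:E)) => //.
- apply/measurable_EFinP; apply: measurable_funM => //.
  exact: measurable_funTS.
- move=> x _ /=; rewrite lee_fin !normrM mulrC ler_wpM2r//.
  by rewrite (le_trans (hM x))// ler_norm.
- exact: int01Z.
Qed.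

Lemma int01_cst (a : R) : int01 (fun=> a).
Proof.
apply: continuous_compact_integrable; first exact: segment_compact.
by apply: continuous_subspaceT => x; exact: cst_continuous.
Qed.

Definition cos_tau (x : R) : R := cos (2 * pi * x).
Definition sin_tau (x : R) : R := sin (2 * pi * x).

Lemma continuous_cos_tauM (m : R) : continuous (fun x => cos_tau (m * x)).
Proof.
have -> : (fun x => cos_tau (m * x)) = cos \o *%R (2 * pi * m).
  by apply/funext => x; rewrite /cos_tau /= !mulrA.
by move=> x; apply: continuous_comp; [exact: mulrl_continuous|exact: continuous_cos].
Qed.

Lemma continuous_sin_tauM (m : R) : continuous (fun x => sin_tau (m * x)).
Proof.
have -> : (fun x => sin_tau (m * x)) = sin \o *%R (2 * pi * m).
  by apply/funext => x; rewrite /sin_tau /= !mulrA.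
by move=> x; apply: continuous_comp; [exact: mulrl_continuous|exact: continuous_sin].
Qed.

Lemma measurable_cos_tauM (m : R) : measurable_fun setT (fun x => cos_tau (m * x)).
Proof. by apply: continuous_measurable_fun; exact: continuous_cos_tauM. Qed.

Lemma measurable_sin_tauM (m : R) : measurable_fun setT (fun x => sin_tau (m * x)).
Proof. by apply: continuous_measurable_fun; exact: continuous_sin_tauM. Qed.

Lemma norm_cos_tau x : `|cos_tau x| <= 1.
Proof. by rewrite ler_norml cos_geN1 cos_le1. Qed.

Lemma norm_sin_tau x : `|sin_tau x| <= 1.
Proof. by rewrite ler_norml sin_geN1 sin_le1. Qed.

Lemma int01Mcos u (m : R) : int01 u -> int01 (fun x => u x * cos_tau (m * x)).
Proof.
move=> iu; apply: (@int01M_bounded _ _ 1) => // [|x]; last exact: norm_cos_tau.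
exact: measurable_cos_tauM.
Qed.

Lemma int01Msin u (m : R) : int01 u -> int01 (fun x => u x * sin_tau (m * x)).
Proof.
move=> iu; apply: (@int01M_bounded _ _ 1) => // [|x]; last exact: norm_sin_tau.
exact: measurable_sin_tauM.
Qed.

(** Letting [m] run through all of [int] makes the class stable under frequency shifts by one in
    both directions, which is what products with [cos_tau] and [sin_tau] produce. *)
Definition trig_orthogonal u : Prop :=
  int01 u /\ forall m : int,
    \int[mu]_(x in I01) (u x * cos_tau (m%:~R * x)) = 0 /\
    \int[mu]_(x in I01) (u x * sin_tau (m%:~R * x)) = 0.

Lemma trig_orthogonalD u v : trig_orthogonal u -> trig_orthogonal v ->
  trig_orthogonal (fun x => u x + v x).
Proof.
move=> [iu ou] [iv ov]; split; first exact: int01D.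
move=> m; have [u1 u2] := ou m; have [v1 v2] := ov m; split.
- under eq_Rintegral do rewrite mulrDl.
  rewrite Rint01D ?u1 ?v1 ?addr0//; exact: int01Mcos.
- under eq_Rintegral do rewrite mulrDl.
  rewrite Rint01D ?u2 ?v2 ?addr0//; exact: int01Msin.
Qed.

Lemma trig_orthogonalZ (a : R) u : trig_orthogonal u ->
  trig_orthogonal (fun x => a * u x).
Proof.
move=> [iu ou]; split; first exact: int01Z.
move=> m; have [u1 u2] := ou m; split.
- under eq_Rintegral do rewrite -mulrA.
  rewrite Rint01Z ?u1 ?mulr0//; exact: int01Mcos.
- under eq_Rintegral do rewrite -mulrA.
  rewrite Rint01Z ?u2 ?mulr0//; exact: int01Msin.
Qed.

Lemma cos_tauD x y : cos_tau (x + y) = cos_tau x * cos_tau y - sin_tau x * sin_tau y.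
Proof. by rewrite /cos_tau mulrDr cosD. Qed.

Lemma sin_tauD x y : sin_tau (x + y) = sin_tau x * cos_tau y + cos_tau x * sin_tau y.
Proof. by rewrite /sin_tau mulrDr sinD. Qed.

Lemma cos_tauN x : cos_tau (- x) = cos_tau x.
Proof. by rewrite /cos_tau mulrN cosN. Qed.

Lemma sin_tauN x : sin_tau (- x) = - sin_tau x.
Proof. by rewrite /sin_tau mulrN sinN. Qed.

(** Product-to-sum: an integral against frequency [m] becomes a half-sum of integrals at [m + 1] and
    [m - 1], both zero. With [sin_tau] a half-difference appears instead. *)
Lemma trig_orthogonalMcos u : trig_orthogonal u ->
  trig_orthogonal (fun x => u x * cos_tau x).
Proof.
move=> [iu ou]; split.
  by have := int01Mcos 1 iu; under eq_fun do rewrite mul1r.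
move=> m; have [p1 p2] := ou (m + 1); have [q1 q2] := ou (m - 1).
have ic (k : int) : int01 (fun x => u x * cos_tau (k%:~R * x)).
  exact: int01Mcos.
have iS (k : int) : int01 (fun x => u x * sin_tau (k%:~R * x)).
  exact: int01Msin.
split.
- transitivity (\int[mu]_(x in I01)
    (2^-1 * (u x * cos_tau ((m + 1)%:~R * x) + u x * cos_tau ((m - 1)%:~R * x)))).
    apply: eq_Rintegral => x _.
    rewrite !intrD mulrNz !mulrDl !mulNr !mul1r !cos_tauD cos_tauN sin_tauN.
    by field.
  rewrite Rint01Z//; last exact: int01D.
  by rewrite Rint01D// p1 q1 addr0 mulr0.
- transitivity (\int[mu]_(x in I01)
    (2^-1 * (u x * sin_tau ((m + 1)%:~R * x) + u x * sin_tau ((m - 1)%:~R * x)))).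
    apply: eq_Rintegral => x _.
    rewrite !intrD mulrNz !mulrDl !mulNr !mul1r !sin_tauD cos_tauN sin_tauN.
    by field.
  rewrite Rint01Z//; last exact: int01D.
  by rewrite Rint01D// p2 q2 addr0 mulr0.
Qed.

Lemma trig_orthogonalMsin u : trig_orthogonal u ->
  trig_orthogonal (fun x => u x * sin_tau x).
Proof.
move=> [iu ou]; split.
  by have := int01Msin 1 iu; under eq_fun do rewrite mul1r.
move=> m; have [p1 p2] := ou (m + 1); have [q1 q2] := ou (m - 1).
have ic (k : int) : int01 (fun x => u x * cos_tau (k%:~R * x)).
  exact: int01Mcos.
have iS (k : int) : int01 (fun x => u x * sin_tau (k%:~R * x)).
  exact: int01Msin.
split.
- transitivity (\int[mu]_(x in I01)
    (2^-1 * (u x * sin_tau ((m + 1)%:~R * x) + (-1) * (u x * sin_tau ((m - 1)%:~R * x))))).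
    apply: eq_Rintegral => x _.
    rewrite !intrD mulrNz !mulrDl !mulNr !mul1r !sin_tauD cos_tauN sin_tauN.
    by field.
  rewrite Rint01Z//; last by apply: int01D => //; exact: int01Z.
  rewrite Rint01D//; last exact: int01Z.
  by rewrite Rint01Z// p2 q2 mulr0 addr0 mulr0.
- transitivity (\int[mu]_(x in I01)
    (2^-1 * (u x * cos_tau ((m - 1)%:~R * x) + (-1) * (u x * cos_tau ((m + 1)%:~R * x))))).
    apply: eq_Rintegral => x _.
    rewrite !intrD mulrNz !mulrDl !mulNr !mul1r !cos_tauD cos_tauN sin_tauN.
    by field.
  rewrite Rint01Z//; last by apply: int01D => //; exact: int01Z.
  rewrite Rint01D//; last exact: int01Z.
  by rewrite Rint01Z// p1 q1 mulr0 addr0 mulr0.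
Qed.

(* [2 sin (pi x) sin (pi (b - x)) = cos (2 pi x - pi b) - cos (pi b)], so this is
   a trigonometric polynomial; on [0 < x < 1] it is below [1/2] iff [x < b]. *)
Definition step_base (b x : R) : R := 2^-1 - sin (pi * x) * sin (pi * (b - x)) / 2.

Lemma step_baseE b x : step_base b x = (2^-1 + cos (pi * b) / 4) +
  (- (cos (pi * b) / 4)) * cos_tau x + (- (sin (pi * b) / 4)) * sin_tau x.
Proof.
rewrite /step_base /cos_tau /sin_tau.
have -> : 2 * pi * x = pi * x + pi * x by ring.
rewrite cosD sinD mulrBr sinB.
have := cos2Dsin2 (pi * x); set c := cos _; set s := sin _ => e.
have -> : c * c = 1 - s * s by rewrite -e !expr2; ring.
by field.
Qed.

Lemma step_base_itv b x : 0 <= step_base b x <= 1.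
Proof.
have h y : `|sin y| <= 1 :> R by rewrite ler_norml sin_geN1 sin_le1.
have : `|sin (pi * x) * sin (pi * (b - x))| <= 1.
  by rewrite normrM mulr_ile1.
by rewrite ler_norml /step_base; lra.
Qed.

Lemma measurable_step_base b : measurable_fun setT (step_base b).
Proof.
have -> : step_base b = fun x => (2^-1 + cos (pi * b) / 4) +
  (- (cos (pi * b) / 4)) * cos_tau (1 * x) + (- (sin (pi * b) / 4)) * sin_tau (1 * x).
  by apply/funext => x; rewrite mul1r step_baseE.
apply: measurable_funD; [apply: measurable_funD => //|];
apply: measurable_funM => //; [exact: measurable_cos_tauM|exact: measurable_sin_tauM].
Qed.

Lemma trig_orthogonalM_step_base b u : trig_orthogonal u ->
  trig_orthogonal (fun x => u x * step_base b x).
Proof.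
move=> ou.
have -> : (fun x => u x * step_base b x) = fun x =>
   (2^-1 + cos (pi * b) / 4) * u x +
   (- (cos (pi * b) / 4)) * (u x * cos_tau x) + (- (sin (pi * b) / 4)) * (u x * sin_tau x).
  by apply/funext => x; rewrite step_baseE; ring.
apply: trig_orthogonalD; [apply: trig_orthogonalD|]; apply: trig_orthogonalZ => //.
  exact: trig_orthogonalMcos.
exact: trig_orthogonalMsin.
Qed.

Lemma trig_orthogonal_int0 u : trig_orthogonal u -> \int[mu]_(x in I01) u x = 0.
Proof.
move=> [_ /(_ 0)[h _]]; rewrite -[RHS]h; apply: eq_Rintegral => x _.
by rewrite mul0r /cos_tau mulr0 cos0 mulr1.
Qed.

(** Multiplication by [step_base b] preserves orthogonality, hence so does multiplication by any
    polynomial in it; frequency 0 then gives the integral. *)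
Lemma trig_orthogonal_step b n u : trig_orthogonal u ->
  \int[mu]_(x in I01) (u x * (1 - step_base b x ^+ n) ^+ (2 ^ n)) = 0.
Proof.
move=> ou; apply: trig_orthogonal_int0.
have H1 v k : trig_orthogonal v -> trig_orthogonal (fun x => v x * step_base b x ^+ k).
  move=> ov; elim: k => [|k IH].
    by under eq_fun do rewrite expr0 mulr1.
  under eq_fun do rewrite exprSr mulrA.
  exact: trig_orthogonalM_step_base.
(* With [y = step_base b x], the induction peels one factor: [(1 - y^n)^(k+1) = (1 - y^n)^k - (1 -
   y^n)^k y^n]. *)
elim: (2 ^ n)%N => [|k IH]; first by under eq_fun do rewrite expr0 mulr1.
have -> : (fun x => u x * (1 - step_base b x ^+ n) ^+ k.+1) = fun x =>
   u x * (1 - step_base b x ^+ n) ^+ k +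
   (-1) * (u x * (1 - step_base b x ^+ n) ^+ k * step_base b x ^+ n).
  by apply/funext => x; rewrite exprSr; ring.
by apply: trig_orthogonalD => //; apply/trig_orthogonalZ/H1.
Qed.

End TrigonometricSystem.

(** * Step functions as limits of trigonometric polynomials, and vanishing almost everywhere *)

Section TrigonometricCompleteness.
Context {R : realType}.
Local Notation mu := (@lebesgue_measure R).
Local Notation I01 := (`[0%R, 1%R]%classic : set R).
Implicit Types u v h : R -> R.

Lemma bernoulli_inequality (t : R) n : -1 <= t -> 1 + n%:R * t <= (1 + t) ^+ n.
Proof.
move=> t1; elim: n => [|n IH]; first by rewrite mul0r addr0 expr0.
rewrite exprSr; apply: le_trans (ler_wpM2r _ IH); last lra.
have h : 0 <= n%:R * (t * t) by rewrite mulr_ge0// -expr2 sqr_ge0.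
rewrite -natr1; nra.
Qed.

(** Bernoulli with [t = - y^n] traps the sequence between [1 - (2 y)^n] and 1, and here
    [2 y < 1]. *)
Lemma step_approx_lt (y : R) : 0 <= y -> y < 2^-1 ->
  (1 - y ^+ n) ^+ (2 ^ n) @[n --> \oo] --> (1 : R).
Proof.
move=> y0 y2.
have yn01 n : 0 <= y ^+ n <= 1 by rewrite exprn_ge0//= exprn_ile1//; lra.
apply: (@squeeze_cvgr _ _ _ _ (fun n => 1 - (2 * y) ^+ n) (cst 1)).
- apply: nearW => n; have := yn01 n => /andP[p q]; apply/andP; split; last first.
    by rewrite /= exprn_ile1//; lra.
  have := @bernoulli_inequality (- y ^+ n) (2 ^ n); rewrite exprMn natrX => H.
  have {H} := H ltac:(lra); lra.
- rewrite -[X in _ --> X]subr0; apply: cvgB; first exact: cvg_cst.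
  by apply: cvg_expr; rewrite ger0_norm; lra.
- exact: cvg_cst.
Qed.

(** The product with [(1 + y^n)^(2^n)] is [(1 - y^(2n))^(2^n)], at most 1, while Bernoulli makes
    that factor at least [(2 y)^n]. The sequence is therefore at most [(2 y)^-n], with [2 y > 1]. *)
Lemma step_approx_gt (y : R) : 2^-1 < y -> y <= 1 ->
  (1 - y ^+ n) ^+ (2 ^ n) @[n --> \oo] --> (0 : R).
Proof.
move=> y2 y1.
have yn01 n : 0 <= y ^+ n <= 1 by rewrite exprn_ge0 ?exprn_ile1//; lra.
have Y : 0 < 2 * y by lra.
apply: (@squeeze_cvgr _ _ _ _ (cst 0) (fun n => (2 * y)^-1 ^+ n)).
- apply: nearW => n; have := yn01 n => /andP[p q]; apply/andP; split.
    by rewrite /= exprn_ge0//; lra.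
  have := @bernoulli_inequality (y ^+ n) (2 ^ n) => H.
  have {H} H := H ltac:(lra).
  rewrite exprVn -[leRHS]mul1r ler_pdivlMr ?exprn_gt0//.
  apply: (@le_trans _ _ ((1 - y ^+ n) ^+ (2 ^ n) * (1 + y ^+ n) ^+ (2 ^ n))).
    apply: ler_wpM2l; first by rewrite exprn_ge0//; lra.
    apply: le_trans H; rewrite exprMn natrX; lra.
  rewrite -exprMn exprn_ile1//; nra.
- exact: cvg_cst.
- by apply: cvg_expr; rewrite ger0_norm ?invr_ge0 ?(ltW Y)// invf_lt1//; lra.
Qed.

Lemma step_base_lt (b x : R) : 0 < x -> x < b -> b <= 1 -> step_base b x < 2^-1.
Proof.
move=> x0 xb b1; have p0 := @pi_gt0 R.
have : 0 < sin (pi * x) * sin (pi * (b - x)); last by rewrite /step_base; lra.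
by apply: mulr_gt0; apply: sin_gt0_pi; rewrite ?mulr_gt0 ?subr_gt0//=; nra.
Qed.

Lemma step_base_gt (b x : R) : 0 <= b -> b < x -> x < 1 -> 2^-1 < step_base b x.
Proof.
move=> b0 bx x1; have p0 := @pi_gt0 R.
have : 0 < sin (pi * x) * sin (pi * (x - b)).
  by apply: mulr_gt0; apply: sin_gt0_pi; nra.
rewrite /step_base -(opprB x b) mulrN sinN; lra.
Qed.

Lemma ae_lebesgue_neq (a : R) : {ae mu, forall x, x <> a}.
Proof.
exists [set a]; split => //; first exact: lebesgue_measure_set1.
by move=> x /= /contrapT.
Qed.

(** Dominated convergence with bound [|u|]: the integrals of [gn n] are all zero and tend to the
    integral of [u] over [[0, b]]. *)
Lemma trig_orthogonal_int_itv u (b : R) : 0 < b -> b < 1 -> trig_orthogonal u ->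
  \int[mu]_(x in `[0, b]) u x = 0.
Proof.
move=> b0 b1 ou; have [iu _] := ou.
pose g x := u x * \1_(`[0, b]%classic) x.
pose gn n x := u x * (1 - step_base b x ^+ n) ^+ (2 ^ n).
have m0 : measurable_fun I01 u by apply/measurable_EFinP; exact: measurable_int iu.
have mgn n : measurable_fun I01 (EFin \o gn n).
  apply/measurable_EFinP; apply: measurable_funM => //; apply: measurable_funTS.
  apply: measurable_funX; apply: measurable_funB => //.
  by apply: measurable_funX; exact: measurable_step_base.
have mg : measurable_fun I01 (EFin \o g).
  by apply/measurable_EFinP; apply: measurable_funM => //.
have bnd n x : 0 <= (1 - step_base b x ^+ n) ^+ (2 ^ n) <= 1.
  have /andP[p q] := step_base_itv b x.
  have p' : 0 <= step_base b x ^+ n by rewrite exprn_ge0.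
  have q' : step_base b x ^+ n <= 1 by rewrite exprn_ile1.
  by rewrite exprn_ge0 ?exprn_ile1//=; lra.
have [] := @dominated_convergence _ _ _ mu I01 _ (fun n => EFin \o gn n) (EFin \o g)
   (fun x => `|u x|%:E) mgn mg.
- by [].
(* At 0, [b] and 1 the base equals [1/2] and the powers tend to [1/e], so these points are set
   aside. *)
- have := ae_lebesgue_neq 0; have := ae_lebesgue_neq b; have := ae_lebesgue_neq 1.
  apply: filterS3; first exact: (ae_filter_ringOfSetsType mu).
  move=> x x1 xb x0 /=; rewrite in_itv/= => /andP[x0' x1'].
  apply: cvg_EFin; first by apply: nearW.
  have X0 : 0 < x by rewrite lt_neqAle eq_sym x0' andbT; exact/eqP.
  have X1 : x < 1 by rewrite lt_neqAle x1' andbT; exact/eqP.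
  apply: cvgMl_tmp; rewrite indicE.
  have [xlb|blx|/xb//] := ltgtP x b.
  + rewrite mem_set/= ?in_itv/= ?x0' ?(ltW xlb)//.
    apply: step_approx_lt; first by have /andP[] := step_base_itv b x.
    by apply: step_base_lt => //; exact: ltW.
  + rewrite memNset/= ?in_itv/= ?x0' /=; last by rewrite leNgt blx.
    apply: step_approx_gt; last by have /andP[] := step_base_itv b x.
    by apply: step_base_gt => //; exact: ltW.
- exact: integrable_norm.
- apply: nearW => x n _ /=; rewrite lee_fin normrM ler_piMr//.
  by have /andP[p q] := bnd n x; rewrite ger0_norm.
move=> _ _ cv.
have : (\int[mu]_(x in I01) (EFin \o g) x)%E = 0%E.
  have <- := cvg_lim _ cv => //.
  apply: lim_near_cst => //; apply: nearW => n.
  have h := trig_orthogonal_step b n ou.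
  rewrite -[LHS]fineK; first by congr EFin.
  apply: integrable_fin_num => //.
  apply: (@le_integrable _ _ _ mu _ _ _ (EFin \o u)) => // [|x _ /=].
    exact: mgn.
  rewrite lee_fin normrM ler_piMr//.
  by have /andP[p q] := bnd n x; rewrite ger0_norm.
rewrite /Rintegral => h; rewrite -[RHS]/(fine 0%E) -h; congr fine.
rewrite (_ : `[0, b]%classic = I01 `&` `[0, b]); last first.
  apply/seteqP; split=> x /=; rewrite !in_itv/=; first by move=> /andP[p q]; lra.
  by case.
rewrite integral_mkcondr; apply: eq_integral => x _.
by rewrite /patch /g /= indicE; case: ifPn => _; rewrite ?mulr1 ?mulr0.
Qed.

Lemma trig_orthogonal_eq0 u : trig_orthogonal u -> {ae mu, forall x, I01 x -> u x = 0}.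
Proof.
move=> ou; have [iu _] := ou.
pose f := u \_ I01.
have ifT : mu.-integrable setT (EFin \o f).
  have := iu; rewrite /int01 integrable_mkcond//; apply: eq_integrable => // x _.
  by rewrite /f /patch /=; case: ifP.
have ifb y : mu.-integrable [set` Interval (BLeft 0) (BRight y)] (EFin \o f).
  by apply: integrableS ifT.
have := FTC1 ifb (open_integrable_locally openT ifT).
rewrite (_ : (fun x => _) = cst 0).
  have := ae_lebesgue_neq 0.
  apply: filterS2; first exact: (ae_filter_ringOfSetsType mu).
  move=> x x_neq0 h; rewrite /= in_itv/= => /andP[x0 x1].
  have X : 0 < x by rewrite lt_neqAle eq_sym x0 andbT; exact/eqP.
  have [|_] := h; first by rewrite /Order.lt /=.
  by rewrite derive1_cst /f patchE mem_set//= in_itv/= x0.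
(* The primitive vanishes on the whole line. The domain of integration is empty for [x < 0], a point
   for [x = 0], the segment [[0, x]] for [0 < x < 1], and all of [I01] from [x = 1] on. *)
apply/funext => x /=.
transitivity (\int[mu]_(t in `[0, x] `&` I01) u t).
  by rewrite Rintegral_mkcondr; apply: eq_Rintegral.
have [x0|x0] := ltP x 0.
  rewrite (_ : _ `&` _ = set0) ?Rintegral_set0//.
  by apply/seteqP; split=> // y /=; rewrite !in_itv/=; lra.
have [->|x0'] := eqVneq x 0.
  rewrite (_ : _ `&` _ = [set 0]) ?Rintegral_set1//.
  apply/seteqP; split=> y /=; rewrite !in_itv/= ?lexx ?ler01//.
    by move=> [/andP[p q] _]; apply/eqP; rewrite eq_le p q.
  by move=> ->; rewrite lexx ler01.
have X0 : 0 < x by rewrite lt_neqAle eq_sym x0' x0.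
have [x1|x1] := ltP x 1.
  rewrite (_ : _ `&` _ = `[0, x]%classic) ?trig_orthogonal_int_itv//.
  by apply/seteqP; split=> y /=; rewrite !in_itv/=; [case|move=> /andP[p q]; rewrite p q; lra].
rewrite (_ : _ `&` _ = I01) ?trig_orthogonal_int0//.
by apply/seteqP; split=> y /=; rewrite !in_itv/=;
  [case|move=> /andP[p q]; rewrite p q (le_trans q)].
Qed.
End TrigonometricCompleteness.

(** * Square-integrable functions and Fourier coefficients *)

Section ComplexL2.
Context {R : realType}.
Local Notation C := R[i].
Local Notation mu := (@lebesgue_measure R).
Local Notation I01 := (`[0%R, 1%R]%classic : set R).
Implicit Types (f g : R -> C) (z w c : C).
Local Notation Re := complex.Re.
Local Notation Im := complex.Im.

Lemma ReD z w : Re (z + w) = Re z + Re w. Proof. by case: z w => [? ?] []. Qed.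
Lemma ImD z w : Im (z + w) = Im z + Im w. Proof. by case: z w => [? ?] []. Qed.
Lemma ReM z w : Re (z * w) = Re z * Re w - Im z * Im w.
Proof. by case: z w => [? ?] []. Qed.
Lemma ImM z w : Im (z * w) = Re z * Im w + Im z * Re w.
Proof. by case: z w => [? ?] []. Qed.
Lemma ReN z : Re (- z) = - Re z. Proof. by case: z. Qed.
Lemma ImN z : Im (- z) = - Im z. Proof. by case: z. Qed.

Lemma eq_ReIm z w : Re z = Re w -> Im z = Im w -> z = w.
Proof. by case: z w => [a b] [c d] /= -> ->. Qed.

Lemma sqnormCE z : sqnormC z = Re z ^+ 2 + Im z ^+ 2.
Proof. by case: z. Qed.

Lemma sqnormC_ge0 z : 0 <= sqnormC z.
Proof. by rewrite sqnormCE addr_ge0// sqr_ge0. Qed.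

Lemma sqnormCM z w : sqnormC (z * w) = sqnormC z * sqnormC w.
Proof. by rewrite !sqnormCE ReM ImM; ring. Qed.

Lemma sqnormC0 : sqnormC (0 : C) = 0.
Proof. by rewrite sqnormCE /= expr0n addr0. Qed.

Lemma sqnormC_eq0 z : sqnormC z = 0 -> z = 0.
Proof.
rewrite sqnormCE => /eqP; rewrite paddr_eq0 ?sqr_ge0// !sqrf_eq0.
by move=> /andP[/eqP a /eqP b]; apply: eq_ReIm.
Qed.

Lemma sqnormCD_le z w : sqnormC (z + w) <= 2 * (sqnormC z + sqnormC w).
Proof.
rewrite !sqnormCE ReD ImD.
have := sqr_ge0 (Re z - Re w); have := sqr_ge0 (Im z - Im w); rewrite !expr2; lra.
Qed.

Definition expi (x : R) : C := Complex (cos_tau x) (sin_tau x).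

Lemma expiD x y : expi (x + y) = expi x * expi y.
Proof.
apply: eq_ReIm; rewrite ?ReM ?ImM /= ?cos_tauD ?sin_tauD; ring.
Qed.

Lemma expi0 : expi 0 = 1.
Proof. by apply: eq_ReIm; rewrite /= /cos_tau /sin_tau mulr0 ?cos0 ?sin0. Qed.

Lemma expiNK x : expi (- x) * expi x = 1.
Proof. by rewrite -expiD addNr expi0. Qed.

Lemma sqnormC_expi x : sqnormC (expi x) = 1.
Proof. by rewrite sqnormCE /= cos2Dsin2. Qed.

Definition cmeasurable f := measurable_fun setT (fun x => Re (f x)) /\
  measurable_fun setT (fun x => Im (f x)).

Lemma cmeasurableD f g : cmeasurable f -> cmeasurable g ->
  cmeasurable (fun x => f x + g x).
Proof.
move=> [f1 f2] [g1 g2]; split.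
  by under eq_fun do rewrite ReD; apply: measurable_funD.
by under eq_fun do rewrite ImD; apply: measurable_funD.
Qed.

Lemma cmeasurableM f g : cmeasurable f -> cmeasurable g ->
  cmeasurable (fun x => f x * g x).
Proof.
move=> [f1 f2] [g1 g2]; split.
  by under eq_fun do rewrite ReM; apply: measurable_funB; apply: measurable_funM.
by under eq_fun do rewrite ImM; apply: measurable_funD; apply: measurable_funM.
Qed.

Lemma cmeasurable_cst c : cmeasurable (fun=> c).
Proof. by split; exact: measurable_cst. Qed.

Lemma cmeasurable_expi (a : R) : cmeasurable (fun x => expi (a * x)).
Proof. by split; [exact: measurable_cos_tauM|exact: measurable_sin_tauM]. Qed.

Lemma measurable_sqnormC f : cmeasurable f -> measurable_fun setT (fun x => sqnormC (f x)).
Proof.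
move=> [f1 f2]; under eq_fun do rewrite sqnormCE.
by apply: measurable_funD; apply: measurable_funX.
Qed.

Definition sqnorm01 f : \bar R := (\int[mu]_(x in I01) (sqnormC (f x))%:E)%E.

Definition L2 f := cmeasurable f /\ (sqnorm01 f < +oo)%E.

Lemma L2_sqnorm f : L2 f -> int01 (fun x => sqnormC (f x)).
Proof.
move=> [mf nf]; apply/integrableP; split.
  by apply/measurable_EFinP; apply: measurable_funTS; exact: measurable_sqnormC.
rewrite (le_lt_trans _ nf)// le_eqVlt; apply/orP; left; apply/eqP.
by apply: eq_integral => x _ /=; rewrite ger0_norm// sqnormC_ge0.
Qed.

Lemma L2_le f (h : R -> R) : cmeasurable f -> int01 h ->
  (forall x, sqnormC (f x) <= h x) -> L2 f.
Proof.
move=> mf ih fh; split => //.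
have : int01 (fun x => sqnormC (f x)).
  apply: (@le_integrable _ _ _ mu _ _ _ (EFin \o h)) => //.
    by apply/measurable_EFinP; apply: measurable_funTS; exact: measurable_sqnormC.
  move=> x _ /=; rewrite lee_fin ger0_norm ?sqnormC_ge0//.
  by rewrite (le_trans (fh x))// ler_norm.
by move/integrable_lty; apply.
Qed.

Lemma L2D f g : L2 f -> L2 g -> L2 (fun x => f x + g x).
Proof.
move=> Lf Lg; have [[mf _] [mg _]] := (Lf, Lg).
apply: (@L2_le _ (fun x => 2 * (sqnormC (f x) + sqnormC (g x)))).
- exact: cmeasurableD.
- by apply: int01Z; apply: int01D; exact: L2_sqnorm.
- by move=> x; exact: sqnormCD_le.
Qed.

Lemma L2Z c f : L2 f -> L2 (fun x => c * f x).
Proof.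
move=> Lf; have [mf _] := Lf.
apply: (@L2_le _ (fun x => sqnormC c * (sqnormC (f x)))).
- by apply: cmeasurableM => //; exact: cmeasurable_cst.
- by apply: int01Z; exact: L2_sqnorm.
- by move=> x; rewrite sqnormCM.
Qed.

Lemma L2Mexpi (a : R) f : L2 f -> L2 (fun x => expi (a * x) * f x).
Proof.
move=> Lf; have [mf _] := Lf.
apply: (@L2_le _ (fun x => sqnormC (f x))).
- by apply: cmeasurableM => //; exact: cmeasurable_expi.
- exact: L2_sqnorm.
- by move=> x; rewrite sqnormCM sqnormC_expi mul1r.
Qed.

Lemma L2_cst c : L2 (fun=> c).
Proof.
by apply: (@L2_le _ (fun=> sqnormC c)) => //; exact: int01_cst.
Qed.

Lemma L2B f g : L2 f -> L2 g -> L2 (fun x => f x - g x).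
Proof.
move=> Lf Lg; under eq_fun do rewrite -mulN1r; apply: L2D => //; exact: L2Z.
Qed.

(** Finite measure puts L2 inside L1: [|Re f| <= 1 + |f|^2], because [(|Re f| - 1)^2 >= 0]. *)
Lemma L2_Re f : L2 f -> int01 (fun x => Re (f x)).
Proof.
move=> Lf; have [mf _] := Lf.
apply: (@le_integrable _ _ _ mu _ _ _ (EFin \o (fun x => 1 + sqnormC (f x)))) => //.
- by apply/measurable_EFinP; apply: measurable_funTS; case: mf.
- move=> x _ /=; rewrite lee_fin (le_trans _ (ler_norm _))// sqnormCE.
  have := sqr_ge0 (Im (f x)); have := sqr_ge0 (`|Re (f x)| - 1).
  rewrite -(real_normK (num_real (Re (f x)))) !expr2; have := normr_ge0 (Re (f x)); nra.
- by apply: int01D; [exact: int01_cst|exact: L2_sqnorm].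
Qed.

(** Reduces to real parts through [Re (i f) = - Im f]. *)
Lemma L2_Im f : L2 f -> int01 (fun x => Im (f x)).
Proof.
move=> /(L2Z 'i%C) /L2_Re /(int01Z (-1)); congr int01; apply/funext => x.
by rewrite ReM /=; ring.
Qed.

Definition cint01 f : C := Complex (\int[mu]_(x in I01) Re (f x)) (\int[mu]_(x in I01) Im (f x)).

Lemma cint01D f g : L2 f -> L2 g ->
  cint01 (fun x => f x + g x) = cint01 f + cint01 g.
Proof.
move=> Lf Lg; apply: eq_ReIm; rewrite ?ReD ?ImD /=.
- under eq_Rintegral do rewrite ReD.
  by rewrite Rint01D//; exact: L2_Re.
- under eq_Rintegral do rewrite ImD.
  by rewrite Rint01D//; exact: L2_Im.
Qed.

Lemma cint01Z c f : L2 f -> cint01 (fun x => c * f x) = c * cint01 f.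
Proof.
move=> Lf; have [r i] := (L2_Re Lf, L2_Im Lf).
apply: eq_ReIm; rewrite ?ReM ?ImM /=.
- transitivity (\int[mu]_(x in I01) (Re c * Re (f x) + (- Im c) * Im (f x))).
    by apply: eq_Rintegral => x _; rewrite ReM mulNr.
  by rewrite Rint01D ?Rint01Z ?mulNr//; exact: int01Z.
- transitivity (\int[mu]_(x in I01) (Re c * Im (f x) + Im c * Re (f x))).
    by apply: eq_Rintegral => x _; rewrite ImM.
  by rewrite Rint01D ?Rint01Z//; exact: int01Z.
Qed.

Definition fourier_coef f (m : int) : C := cint01 (fun x => expi ((- m)%:~R * x) * f x).

Lemma fourier_coefD f g m : L2 f -> L2 g ->
  fourier_coef (fun x => f x + g x) m = fourier_coef f m + fourier_coef g m.
Proof.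
move=> Lf Lg; rewrite /fourier_coef; under eq_fun do rewrite mulrDr.
by rewrite cint01D//; exact: L2Mexpi.
Qed.

Lemma fourier_coefZ c f m : L2 f -> fourier_coef (fun x => c * f x) m = c * fourier_coef f m.
Proof.
move=> Lf; rewrite /fourier_coef; under eq_fun do rewrite mulrCA.
by rewrite cint01Z//; exact: L2Mexpi.
Qed.

Lemma fourier_coefB f g m : L2 f -> L2 g ->
  fourier_coef (fun x => f x - g x) m = fourier_coef f m - fourier_coef g m.
Proof.
move=> Lf Lg; under eq_fun do rewrite -mulN1r.
by rewrite fourier_coefD ?fourier_coefZ ?mulN1r//; exact: L2Z.
Qed.

Lemma fourier_coefMexpi (k : int) f m :
  fourier_coef (fun x => expi (k%:~R * x) * f x) m = fourier_coef f (m - k).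
Proof.
rewrite /fourier_coef; congr cint01; apply/funext => x.
rewrite mulrA -expiD -mulrDl -intrD; congr (expi (_%:~R * _) * _); lia.
Qed.

Lemma expi_int (k : int) : expi k%:~R = 1.
Proof.
have expi1 : expi 1 = 1.
  have t2 : 2 * pi = pi *+ 2 :> R by rewrite mulr_natl.
  by apply: eq_ReIm; rewrite /= /cos_tau /sin_tau mulr1 t2 ?trigo.cos2pi ?trigo.sin2pi.
have expn (n : nat) : expi n%:R = 1.
  by elim: n => [|n IH]; rewrite ?expi0// -natr1 expiD IH expi1 mulr1.
case: k => n; first exact: expn.
by rewrite NegzE mulrNz -[LHS]mulr1 -[X in _ * X](expn n.+1) expiNK.
Qed.

Lemma Rint01_derive (f F : R -> R) : continuous f ->
  (forall x, is_derive x (1 : R) F (f x)) -> \int[mu]_(x in I01) f x = F 1 - F 0.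
Proof.
move=> cf dF.
have cF : continuous F.
  by move=> x; have [dFx _] := dF x; exact/differentiable_continuous/derivable1_diffP.
rewrite /Rintegral (@continuous_FTC2 _ _ F 0 1)//.
- by apply: continuous_subspaceT.
- split.
  + by move=> x _; have [] := dF x.
  + by apply: cvg_at_right_filter; exact: cF.
  + by apply: cvg_at_left_filter; exact: cF.
- by move=> x _; rewrite derive1E; have [_ ->] := dF x.
Qed.

(** For [k <> 0] put [a = 2 pi k]; the primitives [sin (a x) / a] and [- cos (a x) / a] take equal
    values at 0 and 1. *)
Lemma cint01_expi (k : int) : cint01 (fun x => expi (k%:~R * x)) = (k == 0)%:R.
Proof.
have [->|k0] := eqVneq k 0.
  under eq_fun do rewrite mul0r expi0.
  by apply: eq_ReIm; rewrite /= Rintegral_cst//= lebesgue_measure_itv/= lte_fin ltr01/=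
    ?subr0 ?oppr0 ?addr0 ?adde0 ?mulr1 ?mul0r.
set a : R := 2 * pi * k%:~R.
have a0 : a != 0 by rewrite !mulf_neq0 ?intr_eq0 // gt_eqF// pi_gt0.
have := expi_int k => /eqP; rewrite eq_complex /= /cos_tau /sin_tau -/a.
move=> /andP[/eqP c1 /eqP s0].
have dl x : is_derive x (1 : R) ( *%R a) a.
  by have := is_deriveZ a (is_derive_id x (1 : R)); rewrite /GRing.scale/= mulr1.
apply: eq_ReIm; rewrite /=.
- have dF x : is_derive x (1 : R) (fun x => a^-1 * sin (a * x)) (cos_tau (k%:~R * x)).
    have := is_deriveZ a^-1 (is_derive1_comp (is_derive_sin (a * x)) (dl x)).
    by rewrite /GRing.scale/= mulrCA mulVf// mulr1 /cos_tau mulrA; exact.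
  rewrite (Rint01_derive (@continuous_cos_tauM _ _) dF).
  by rewrite mulr1 s0 !mulr0 sin0 mulr0 subr0.
- have dF x : is_derive x (1 : R) (fun x => - a^-1 * cos (a * x)) (sin_tau (k%:~R * x)).
    have := is_deriveZ (- a^-1) (is_derive1_comp (is_derive_cos (a * x)) (dl x)).
    by rewrite /GRing.scale/= mulrCA mulNr mulNr mulVf// mulrN opprK mulr1 /sin_tau mulrA; exact.
  rewrite (Rint01_derive (@continuous_sin_tauM _ _) dF).
  by rewrite mulr1 c1 !mulr0 cos0 subrr.
Qed.

Lemma fourier_coef_expi (k m : int) : fourier_coef (fun x => expi (k%:~R * x)) m = (k == m)%:R.
Proof.
rewrite -subr_eq0 -cint01_expi; congr cint01; apply/funext => x.
by rewrite -expiD -mulrDl -intrD addrC.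
Qed.
End ComplexL2.

(** * Riesz-Fischer and Parseval *)

Section AeConvergence.
Context {R : realType}.
Local Notation mu := (@lebesgue_measure R).
Local Notation I01 := (`[0%R, 1%R]%classic : set R).

(** Fatou's lemma after replacing [g] by the pointwise lower limit, equal to it almost everywhere.
    It serves to carry norm bounds over to almost-everywhere limits. *)
Lemma ae_fatou (f : nat -> R -> R) (g : R -> R) (M : \bar R) :
  (forall n, measurable_fun setT (f n)) -> measurable_fun setT g ->
  (forall n x, 0 <= f n x) -> (forall x, 0 <= g x) ->
  {ae mu, forall x, I01 x -> f n x @[n --> \oo] --> g x} ->
  (forall n, \int[mu]_(x in I01) (f n x)%:E <= M)%E ->
  (\int[mu]_(x in I01) (g x)%:E <= M)%E.
Proof.
move=> mf mg f0 g0 fg fM.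
have mfE n : measurable_fun I01 (fun x => (f n x)%:E).
  by apply/measurable_EFinP; apply: measurable_funTS.
have mlim : measurable_fun I01 (fun x => limn_einf (fun n => (f n x)%:E)).
  rewrite (_ : (fun x => _) = fun x => limn (einfs (fun n => (f n x)%:E))); last first.
    by apply/funext => x; rewrite limn_einf_lim.
  apply: (emeasurable_fun_cvg (fun n x => einfs (fun n => (f n x)%:E) n)).
    by move=> n; apply: measurable_fun_einfs.
  by move=> x _; exact: is_cvg_einfs.
rewrite (@ge0_ae_eq_integral _ _ _ mu _ _ (fun x => limn_einf (fun n => (f n x)%:E)))//.
- apply: le_trans (fatou mu _ mfE _) _ => //.
    by move=> n x _; rewrite lee_fin.
  rewrite limn_einf_lim; apply: lime_le; first exact: is_cvg_einfs.
  apply: nearW => n; apply: le_trans (fM n).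
  by apply: ereal_inf_lbound; exists n => //=.
- by apply/measurable_EFinP; apply: measurable_funTS.
- by move=> x _; rewrite lee_fin.
- move=> x _; rewrite limn_einf_lim; apply: lime_ge; first exact: is_cvg_einfs.
  by apply: nearW => n; apply: le_ereal_inf_tmp => _ [m /= _ <-]; rewrite lee_fin.
- move: fg; apply: filterS; first exact: (ae_filter_ringOfSetsType mu).
  move=> x h /h {}h.
  have hE : (f n x)%:E @[n --> \oo] --> (g x)%:E by apply/cvg_EFin => //; apply: nearW.
  by rewrite is_cvg_limn_einfE ?(cvg_lim _ hE)//; apply/cvg_ex; eexists; exact: hE.
Qed.

(** Increments of L2 norm at most [2^-k] have L1 norm at most [2^-k]. Their sum [s] is thus
    integrable, hence finite almost everywhere, and there the sequence converges absolutely. *)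
Lemma ae_cvg_geometric (u : nat -> R -> R) :
  (forall k, measurable_fun setT (u k)) ->
  (forall k, \int[mu]_(x in I01) ((u k.+1 x - u k x) ^+ 2)%:E <= (4^-1 ^+ k)%:E)%E ->
  exists2 v : R -> R, measurable_fun setT v &
    {ae mu, forall x, I01 x -> u n x @[n --> \oo] --> v x}.
Proof.
move=> m_u le_u; pose d k x := `|u k.+1 x - u k x|.
have d0 k x : 0 <= d k x by exact: normr_ge0.
have md k : measurable_fun setT (d k).
  by apply: measurableT_comp => //; apply: measurable_funB.
have mdE k : measurable_fun I01 (fun x => (d k x)%:E).
  by apply/measurable_EFinP; apply: measurable_funTS.
have id2 k : int01 (fun x => d k x ^+ 2).
  apply/integrableP; split.
    by apply/measurable_EFinP; apply: measurable_funTS; apply: measurable_funX; exact: md.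
  apply: le_lt_trans (ltry (4^-1 ^+ k)); apply: le_trans (le_u k).
  rewrite le_eqVlt; apply/orP; left; apply/eqP; apply: eq_integral => x _ /=.
  by rewrite /d real_normK ?num_real// ger0_norm// sqr_ge0.
have icst := @int01_cst R.
have dle k : (\int[mu]_(x in I01) (d k x)%:E <= (2^-1 ^+ k)%:E)%E.
  have h2 : (2^-1 : R) ^+ k * 2 ^+ k = 1 by rewrite -exprMn mulVf// expr1n.
  have h4 : (4^-1 : R) ^+ k = 2^-1 ^+ k * 2^-1 ^+ k.
    by rewrite -exprMn; congr (_ ^+ _); field.
  have p2 : 0 < (2 : R) ^+ k by rewrite exprn_gt0.
  have q2 : 0 < (2^-1 : R) ^+ k by rewrite exprn_gt0// invr_gt0.
  (* AM-GM: [d <= (2^-k + 2^k d^2) / 2] *)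
  pose h x := 2^-1 * 2^-1 ^+ k + (2^-1 * 2 ^+ k) * d k x ^+ 2.
  have ih : int01 h by apply: int01D => //; exact: int01Z.
  apply: (@le_trans _ _ (\int[mu]_(x in I01) (h x)%:E)%E).
    apply: ge0_le_integral => //; first by move=> x _; rewrite lee_fin.
    - exact: mdE.
    - by case/integrableP : ih.
    move=> x _; rewrite lee_fin /h.
    have := mulr_ge0 (ltW q2) (sqr_ge0 (2 ^+ k * d k x - 1)); rewrite !expr2.
    move: h2; set A := 2^-1 ^+ k; set B := 2 ^+ k; set D := d k x => h2.
    have -> : A * ((B * D - 1) * (B * D - 1)) =
      (A * B) * (B * (D * D)) - 2 * (A * B) * D + A by ring.
    rewrite h2; lra.
  rewrite -[leLHS]fineK; last by apply: integrable_fin_num => //; exact: ih.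
  rewrite lee_fin -/(Rintegral mu I01 h) Rint01D//; last exact: int01Z.
  rewrite (Rint01Z _ (id2 k)) Rintegral_cst//= lebesgue_measure_itv/= lte_fin ltr01/= subr0 mulr1.
  have : \int[mu]_(x in I01) d k x ^+ 2 <= 4^-1 ^+ k.
    rewrite -lee_fin /Rintegral fineK; last by apply: integrable_fin_num => //; exact: id2.
    apply: le_trans (le_u k); rewrite le_eqVlt; apply/orP; left; apply/eqP.
    by apply: eq_integral => x _; rewrite /d real_normK ?num_real.
  rewrite -(ler_pM2l p2) h4; set J := Rintegral _ _ _ => hJ.
  have : 2 ^+ k * J <= 2^-1 ^+ k by rewrite (le_trans hJ)// mulrCA [2 ^+ k * _]mulrC h2 mulr1.
  rewrite -mulrA; set X := 2 ^+ k * J; set A := 2^-1 ^+ k; lra.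
pose s x := (\sum_(0 <= k <oo) (d k x)%:E)%E.
have i_s : mu.-integrable I01 s.
  apply/integrableP; split.
    by apply: ge0_emeasurable_sum => [k x _ _|k _]; rewrite ?lee_fin//; exact: mdE.
  have s0 x : (0 <= s x)%E by apply: nneseries_ge0 => k _ _; rewrite lee_fin.
  under eq_integral do rewrite gee0_abs//.
  rewrite integral_nneseries//; last by move=> k x _; rewrite lee_fin.
  apply: (@le_lt_trans _ _ (\sum_(0 <= k <oo) (2^-1 ^+ k)%:E)%E).
    by apply: lee_nneseries => // k _ _; apply: integral_ge0 => x _; rewrite lee_fin.
  apply: le_lt_trans (ltry 2); apply: lime_le.
    by apply: is_cvg_nneseries => k _ _; rewrite lee_fin exprn_ge0// invr_ge0.
  apply: nearW => n; rewrite sumEFin lee_fin.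
  suff -> : \sum_(0 <= i < n) (2^-1 : R) ^+ i = 2 - 2 * 2^-1 ^+ n.
    by rewrite gerBl mulr_ge0// exprn_ge0// invr_ge0.
  elim: n => [|n IH]; first by rewrite big_geq// expr0; ring.
  by rewrite big_nat_recr//= IH exprSr; field.
(* The upper limit is measurable on the whole line, including points where [u n x] diverges, and
   equals the limit wherever there is one. *)
exists (fun x => fine (limn_esup (fun n => (u n x)%:E))).
  apply: measurableT_comp => //.
  by apply: measurable_fun_limn_esup => n; apply/measurable_EFinP.
have s_ae : {ae mu, forall x, I01 x -> s x \is a fin_num} by apply: integrable_ae.
move: s_ae; apply: filterS; first exact: (ae_filter_ringOfSetsType mu).
move=> x h /h {}h.
(* The telescoping series has absolute partial sums bounded by the finite [s x]; it yields
   convergence of [u n x - u 0 x]. *)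
have cu : cvgn (u ^~ x).
  have : cvgn (series (telescope (u ^~ x))).
    apply: normed_cvg; apply: nondecreasing_is_cvgn.
      by apply: nondecreasing_series => n _ _; exact: normr_ge0.
    exists (fine (s x)) => _ [n _ <-].
    rewrite -lee_fin fineK// /= -sumEFin.
    by apply: nneseries_lim_ge => k _ _; rewrite lee_fin.
  rewrite telescopeK => /cvg_ex[l cl]; apply/cvg_ex; exists (l + u 0%N x).
  have -> : u ^~ x = fun n => (u n x - u 0%N x) + u 0%N x.
    by apply/funext => n; rewrite subrK.
  by apply: cvgD => //; exact: cvg_cst.
have /cvg_ex[l cl] := cu.
have hE : (u n x)%:E @[n --> \oo] --> l%:E by apply/cvg_EFin => //; apply: nearW.
rewrite is_cvg_limn_esupE; last by apply/cvg_ex; exists l%:E.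
by rewrite (cvg_lim _ hE).
Qed.
End AeConvergence.

(** * Trigonometric polynomials and the removal of one Fourier mode *)

Section Parseval.
Context {R : realType}.
Local Notation C := R[i].
Local Notation mu := (@lebesgue_measure R).
Local Notation I01 := (`[0%R, 1%R]%classic : set R).
Implicit Types (f g : R -> C) (z w c : C) (a : int -> C) (s : seq int).
Local Notation Re := complex.Re.
Local Notation Im := complex.Im.

Lemma Re_expi (x : R) : Re (expi x) = cos_tau x. Proof. by []. Qed.
Lemma Im_expi (x : R) : Im (expi x) = sin_tau x. Proof. by []. Qed.

Definition trig_poly s a (x : R) : C := \sum_(k <- s) a k * expi (k%:~R * x).

Lemma L2_expi (k : R) : L2 (fun x => expi (k * x)).
Proof. by have := L2Mexpi k (L2_cst 1); under eq_fun do rewrite mulr1. Qed.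

Lemma trig_poly_cons k s a :
  trig_poly (k :: s) a = fun x => a k * expi (k%:~R * x) + trig_poly s a x.
Proof. by apply/funext => x; rewrite /trig_poly big_cons. Qed.

Lemma trig_poly_nil a : trig_poly [::] a = fun=> 0.
Proof. by apply/funext => x; rewrite /trig_poly big_nil. Qed.

Lemma L2_trig_poly s a : L2 (trig_poly s a).
Proof.
elim: s => [|k s IH]; first by rewrite trig_poly_nil; exact: L2_cst.
by rewrite trig_poly_cons; apply: L2D => //; apply: L2Z; exact: L2_expi.
Qed.

Lemma fourier_coef_trig_poly s a m : uniq s ->
  fourier_coef (trig_poly s a) m = if m \in s then a m else 0.
Proof.
elim: s => [_|k s IH] /=.
  by rewrite trig_poly_nil -[in LHS](mul0r 0) fourier_coefZ ?mul0r//; exact: L2_cst.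
move=> /andP[ks us]; rewrite trig_poly_cons fourier_coefD; last exact: L2_trig_poly; last first.
  by apply: L2Z; exact: L2_expi.
rewrite fourier_coefZ; last exact: L2_expi.
rewrite fourier_coef_expi IH// in_cons eq_sym.
have [->|] := eqVneq m k; first by rewrite (negbTE ks) mulr1 addr0.
by rewrite mulr0 add0r.
Qed.

Definition rsq f : R := \int[mu]_(x in I01) sqnormC (f x).

Lemma sqnorm01E f : L2 f -> sqnorm01 f = (rsq f)%:E.
Proof.
by move=> /L2_sqnorm h; rewrite /rsq /Rintegral fineK//; apply: integrable_fin_num => //; exact: h.
Qed.

Lemma rsq_ge0 f : 0 <= rsq f.
Proof. by apply: Rintegral_ge0 => x _; exact: sqnormC_ge0. Qed.

Lemma Rint01_cst (r : R) : \int[mu]_(x in I01) r = r.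
Proof.
by rewrite Rintegral_cst//= lebesgue_measure_itv/= lte_fin ltr01/= subr0 mulr1.
Qed.

(** With [e = expi (m x)], pointwise [|f - c e|^2 = |f|^2 + |c|^2 - 2 Re (conj c * conj e * f)]. The
    integral of [conj e * f] is [c] itself, so the last term contributes [- 2 |c|^2]. *)
Lemma rsq_sub_coef f m : L2 f ->
  rsq (fun x => f x - fourier_coef f m * expi (m%:~R * x)) = rsq f - sqnormC (fourier_coef f m).
Proof.
move=> Lf; have Lm := L2Mexpi (- m)%:~R Lf.
set c := fourier_coef f m; rewrite /rsq.
transitivity (\int[mu]_(x in I01) (sqnormC (f x) + (sqnormC c +
   ((- 2 * Re c) * Re (expi ((- m)%:~R * x) * f x) +
    (- 2 * Im c) * Im (expi ((- m)%:~R * x) * f x))))).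
  apply: eq_Rintegral => x _.
  rewrite !sqnormCE !ReD !ImD !ReN !ImN !ReM !ImM !Re_expi !Im_expi mulrNz !mulNr cos_tauN sin_tauN.
  have := cos2Dsin2 (2 * pi * (m%:~R * x)).
  rewrite -/(cos_tau _) -/(sin_tau _); set p := cos_tau _; set q := sin_tau _ => h.
  (* Expanding the left side gives [|c|^2] times [p^2 + q^2]; inserting this factor, equal to 1, on
     the right makes the identity polynomial. *)
  set K := Re c ^+ 2 + Im c ^+ 2.
  have -> : K = K * (p ^+ 2 + q ^+ 2) by rewrite h mulr1.
  by rewrite /K; ring.
have [ir ii] := (L2_Re Lm, L2_Im Lm).
have i1 := int01_cst (sqnormC c).
have i2 := int01Z (- 2 * Re c) ir; have i3 := int01Z (- 2 * Im c) ii.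
rewrite (Rint01D (L2_sqnorm Lf) (int01D i1 (int01D i2 i3))).
rewrite (Rint01D i1 (int01D i2 i3)) (Rint01D i2 i3) Rint01_cst (Rint01Z _ ir) (Rint01Z _ ii).
rewrite -[X in _ * X + _]/(Re c) -[X in _ + _ * X]/(Im c) sqnormCE; ring.
Qed.
End Parseval.

(** * Bessel's identity, Riesz-Fischer, uniqueness and Parseval *)

Section RieszFischer.
Context {R : realType}.
Local Notation C := R[i].
Local Notation mu := (@lebesgue_measure R).
Local Notation I01 := (`[0%R, 1%R]%classic : set R).
Implicit Types (f g : R -> C) (z w c : C) (a : int -> C) (s : seq int).
Local Notation Re := complex.Re.
Local Notation Im := complex.Im.

(** Modes are removed one at a time: since [k] is not in [s], subtracting the modes of [s] leaves
    the [k]-th coefficient unchanged, and [rsq_sub_coef] applies to the remainder. *)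
Lemma bessel_identity s f : uniq s -> L2 f ->
  rsq (fun x => f x - trig_poly s (fourier_coef f) x) =
  rsq f - \sum_(k <- s) sqnormC (fourier_coef f k).
Proof.
elim: s => [_|k s IH] Lf /=.
  by rewrite trig_poly_nil big_nil subr0; under eq_fun do rewrite subr0.
move: Lf => /andP[ks us] Lf; have Lg := L2B Lf (L2_trig_poly s (fourier_coef f)).
rewrite trig_poly_cons big_cons [X in _ = _ - X]addrC opprD addrA -[in RHS]IH//.
have := rsq_sub_coef k Lg; rewrite fourier_coefB//; last exact: L2_trig_poly.
rewrite fourier_coef_trig_poly// (negbTE ks) subr0 => <-.
by congr rsq; apply/funext => x; rewrite opprD addrA addrAC.
Qed.

Lemma bessel_seq s f : uniq s -> L2 f -> \sum_(k <- s) sqnormC (fourier_coef f k) <= rsq f.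
Proof.
by move=> us Lf; rewrite -subr_ge0 -bessel_identity// rsq_ge0.
Qed.

Lemma sqnormC_coef_le f m : L2 f -> sqnormC (fourier_coef f m) <= rsq f.
Proof.
by move=> Lf; have := @bessel_seq [:: m] f isT Lf; rewrite big_seq1.
Qed.

(** Bessel's identity applied to the polynomial itself, whose remainder is zero. *)
Lemma rsq_trig_poly s a : uniq s -> rsq (trig_poly s a) = \sum_(k <- s) sqnormC (a k).
Proof.
move=> us; have := bessel_identity us (L2_trig_poly s a).
rewrite (_ : (fun x => _) = fun=> 0); last first.
  apply/funext => x; rewrite /trig_poly -[RHS](subrr (trig_poly s a x)); congr (_ - _).
  by rewrite big_seq [RHS]big_seq; apply: eq_bigr => k ks; rewrite fourier_coef_trig_poly// ks.
rewrite /rsq; under eq_Rintegral do rewrite sqnormC0.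
rewrite Rint01_cst => /esym/eqP; rewrite subr_eq0 => /eqP ->.
by rewrite big_seq [RHS]big_seq; apply: eq_bigr => k ks; rewrite fourier_coef_trig_poly// ks.
Qed.

Definition ell2sq a : \bar R := (\esum_(m in [set: int]) (sqnormC (a m))%:E)%E.

Lemma le_sum_ell2sq s a : uniq s -> ((\sum_(k <- s) sqnormC (a k))%:E <= ell2sq a)%E.
Proof.
move=> us; apply: esum_ge; exists [set` s]; first by split => //; exact: finite_seq.
by rewrite -fsbig_seq// sumEFin.
Qed.

Lemma bessel f : L2 f -> (ell2sq (fourier_coef f) <= sqnorm01 f)%E.
Proof.
move=> Lf; rewrite sqnorm01E//; apply: ge_ereal_sup => /= _ [X [finX _] <-].
rewrite fsbig_finite// sumEFin lee_fin; apply: bessel_seq => //; exact: finmap.fset_uniq.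
Qed.

(** Frequencies are exhausted along the enumeration of [int] as a countable type. Each list is a
    prefix of the next, and codes that decode to nothing are dropped. *)
Definition first_ints (n : nat) : seq int := pmap (@pickle_inv int) (iota 0 n).

Lemma pmap_pickle_inv_uniq (s : seq nat) : uniq s -> uniq (pmap (@pickle_inv int) s).
Proof. exact/pmap_uniq/pickle_invK. Qed.

Lemma first_intsD n p : first_ints (n + p) =
  first_ints n ++ pmap (@pickle_inv int) (iota n p).
Proof. by rewrite /first_ints iotaD pmap_cat. Qed.

Lemma mem_first_ints (m : int) n : (pickle m < n)%N -> m \in first_ints n.
Proof.
move=> mn; rewrite mem_pmap; apply/mapP; exists (pickle m); last by rewrite pickleK_inv.
by rewrite mem_iota.
Qed.

(** Partial sums along a fast subsequence converge almost everywhere to some [f]. Fatou bounds both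
    [f] and [f - S k], and the second bound identifies the coefficients. The norm inequality in the
    conclusion is the half of Parseval that Bessel does not give. *)
Lemma riesz_fischer a : (ell2sq a < +oo)%E ->
  exists f, [/\ L2 f, forall m, fourier_coef f m = a m & (sqnorm01 f <= ell2sq a)%E].
Proof.
move=> a_fin.
pose T n := \sum_(k <- first_ints n) sqnormC (a k).
have uq n : uniq (first_ints n) by apply: pmap_pickle_inv_uniq; exact: iota_uniq.
have TD n p : T (n + p)%N = T n + \sum_(k <- pmap (@pickle_inv int) (iota n p)) sqnormC (a k).
  by rewrite /T first_intsD big_cat.
have ndT : {homo T : n m / (n <= m)%N >-> n <= m}.
  move=> n m /subnKC <-; rewrite TD lerDl sumr_ge0// => k _; exact: sqnormC_ge0.
have cT : cvgn T.
  apply: nondecreasing_is_cvgn => //; exists (fine (ell2sq a)) => _ [n _ <-].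
  rewrite -lee_fin fineK ?le_sum_ell2sq//.
  by rewrite ge0_fin_numE//; apply: esum_ge0 => m _; rewrite lee_fin sqnormC_ge0.
have T_le n : T n <= limn T by apply: nondecreasing_cvgn_le.
(* The rate [4^-k] is the one asked for by [ae_cvg_geometric]; [k <= M] guarantees that every
   frequency is eventually included. *)
have /choice[M HM] : forall k : nat, exists M : nat,
    (k <= M)%N /\ limn T - T M <= 4^-1 ^+ k.
  move=> k; have e0 : 0 < (4^-1 : R) ^+ k by rewrite exprn_gt0// invr_gt0.
  have /cvgrPdist_le /(_ _ e0) [N _ HN] := cT.
  exists (maxn k N); split; first exact: leq_maxl.
  by have := HN (maxn k N) (leq_maxr _ _); rewrite /= ger0_norm// subr_ge0.
(* A running maximum makes the cut-offs nondecreasing, so [S l - S k] is again a trigonometric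
   polynomial for [k <= l]. *)
pose N k := (\max_(i < k.+1) M i)%N.
have MN k : (M k <= N k)%N by apply: (@leq_bigmax _ (fun i : 'I_k.+1 => M i) ord_max).
have ndN k l : (k <= l)%N -> (N k <= N l)%N.
  move=> kl; apply/bigmax_leqP => i _.
  have il : (i < l.+1)%N by apply: leq_trans (ltn_ord i) _; rewrite ltnS.
  exact: (@leq_bigmax _ (fun i : 'I_l.+1 => M i) (Ordinal il)).
have tail k : limn T - T (N k) <= 4^-1 ^+ k.
  by have [_] := HM k; apply: le_trans; rewrite lerD2l lerN2 ndT.
pose S k := trig_poly (first_ints (N k)) a.
have LS k : L2 (S k) by exact: L2_trig_poly.
have mS k : cmeasurable (S k) by case: (LS k).
have SB k l : (k <= l)%N -> rsq (fun x => S l x - S k x) <= 4^-1 ^+ k.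
  move=> kl; have := ndN _ _ kl => /subnKC e.
  set s := pmap (@pickle_inv int) (iota (N k) (N l - N k)).
  rewrite (_ : (fun x => _) = trig_poly s a); last first.
    apply/funext => x; rewrite /S /trig_poly -[in first_ints (N l)]e first_intsD.
    by rewrite big_cat/= addrAC subrr add0r.
  rewrite rsq_trig_poly; last by apply: pmap_pickle_inv_uniq; exact: iota_uniq.
  apply: le_trans (tail k); rewrite lerBrDl -TD e; exact: T_le.
have L2SB k l : L2 (fun x => S l x - S k x) by exact: L2B.
(* Stated for an abstract [h] so as to serve both the real and the imaginary part. *)
have part (h : C -> R) : (forall z w, h (z - w) = h z - h w) ->
    (forall z, h z ^+ 2 <= sqnormC z) ->
    (forall k, measurable_fun setT (fun x => h (S k x))) ->
  exists2 v : R -> R, measurable_fun setT v &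
    {ae mu, forall x, I01 x -> h (S n x) @[n --> \oo] --> v x}.
  move=> hB hle mh; apply: ae_cvg_geometric => // k.
  apply: (@le_trans _ _ (sqnorm01 (fun x => S k.+1 x - S k x))).
    apply: ge0_le_integral => //.
    - by move=> x _; rewrite lee_fin sqr_ge0.
    - apply/measurable_EFinP; apply: measurable_funTS; apply: measurable_funX.
      by apply: measurable_funB; exact: mh.
    - apply/measurable_EFinP; apply: measurable_funTS; apply: measurable_sqnormC.
      by case: (L2SB k k.+1).
    - by move=> x _; rewrite lee_fin -hB.
  by rewrite sqnorm01E// lee_fin SB.
have [u m_u cu] : exists2 v : R -> R, measurable_fun setT v &
    {ae mu, forall x, I01 x -> Re (S n x) @[n --> \oo] --> v x}.
  apply: part => [z w|z|k]; [by rewrite ReD ReN| |by case: (mS k)].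
  by rewrite sqnormCE lerDl sqr_ge0.
have [v mv cv] : exists2 v : R -> R, measurable_fun setT v &
    {ae mu, forall x, I01 x -> Im (S n x) @[n --> \oo] --> v x}.
  apply: part => [z w|z|k]; [by rewrite ImD ImN| |by case: (mS k)].
  by rewrite sqnormCE lerDr sqr_ge0.
pose f x := Complex (u x) (v x).
have mf : cmeasurable f by [].
have cvS c x : Re (S n x) @[n --> \oo] --> u x -> Im (S n x) @[n --> \oo] --> v x ->
    sqnormC (S n x - c) @[n --> \oo] --> sqnormC (f x - c).
  move=> cx cy; under eq_fun do rewrite sqnormCE.
  rewrite sqnormCE !ReD !ReN !ImD !ImN.
  under eq_fun do rewrite ReD ImD ReN ImN.
  by apply: cvgD; rewrite expr2; under eq_fun do rewrite expr2;
     apply: cvgM; apply: cvgB => //; exact: cvg_cst.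
have f_le : (sqnorm01 f <= ell2sq a)%E.
  apply: (@ae_fatou _ (fun n x => sqnormC (S n x))).
  - by move=> n; exact: measurable_sqnormC.
  - exact: measurable_sqnormC.
  - by move=> n x; exact: sqnormC_ge0.
  - by move=> x; exact: sqnormC_ge0.
  - move: cu cv; apply: filterS2; first exact: (ae_filter_ringOfSetsType mu).
    move=> x cx cy Ix; have := cvS 0 x (cx Ix) (cy Ix).
    by rewrite subr0; under eq_fun do rewrite subr0.
  - by move=> n; rewrite -/(sqnorm01 (S n)) sqnorm01E// rsq_trig_poly// le_sum_ell2sq.
have Lf : L2 f by split => //; exact: le_lt_trans a_fin.
exists f; split => // m; apply/eqP; rewrite -subr_eq0; apply/eqP/sqnormC_eq0.
(* The Cauchy bound on [S (k + n) - S k] passes to the limit in [n], with [k] fixed. *)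
have fS k : rsq (fun x => f x - S k x) <= 4^-1 ^+ k.
  have Lk := L2B Lf (LS k).
  rewrite -lee_fin -sqnorm01E//.
  apply: (@ae_fatou _ (fun n x => sqnormC (S (k + n)%N x - S k x))).
  - by move=> n; apply: measurable_sqnormC; case: (L2SB k (k + n)%N).
  - by apply: measurable_sqnormC; case: Lk.
  - by move=> n x; exact: sqnormC_ge0.
  - by move=> x; exact: sqnormC_ge0.
  - move: cu cv; apply: filterS2; first exact: (ae_filter_ringOfSetsType mu).
    move=> x cx cy Ix; have := cvS (S k x) x (cx Ix) (cy Ix).
    by rewrite -(cvg_shiftn k); under eq_fun do rewrite addnC.
  - move=> n; rewrite -/(sqnorm01 (fun x => S (k + n)%N x - S k x)) sqnorm01E//.
    by rewrite lee_fin SB// leq_addr.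
(* Once [m] is among the frequencies of [S k], the [m]-th coefficient of [f - S k] is
   [fourier_coef f m - a m], bounded by the norm just estimated. *)
have le_k k : (pickle m < k)%N -> sqnormC (fourier_coef f m - a m) <= 4^-1 ^+ k.
  move=> mk; apply: le_trans (fS k); have Lk := L2B Lf (LS k).
  have := sqnormC_coef_le m Lk; rewrite fourier_coefB// fourier_coef_trig_poly// mem_first_ints//.
  by apply: leq_trans mk _; have [kM _] := HM k; exact: leq_trans (MN k).
apply/eqP; rewrite eq_le sqnormC_ge0 andbT.
have c0 : (4^-1 : R) ^+ n @[n --> \oo] --> 0 by apply: cvg_expr; rewrite ger0_norm; lra.
rewrite -(cvg_lim _ c0)//; apply: limr_ge; first by apply/cvg_ex; exists 0.
by exists (pickle m).+1 => // k /= mk; exact: le_k.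
Qed.

Lemma Re_fourier_coef f (m : int) : L2 f -> Re (fourier_coef f m) =
  \int[mu]_(x in I01) (Re (f x) * cos_tau (m%:~R * x)) +
  \int[mu]_(x in I01) (Im (f x) * sin_tau (m%:~R * x)).
Proof.
move=> Lf; have [ir ii] := (L2_Re Lf, L2_Im Lf).
rewrite -(Rint01D (int01Mcos _ ir) (int01Msin _ ii)).
by apply: eq_Rintegral => x _; rewrite ReM Re_expi Im_expi mulrNz mulNr cos_tauN sin_tauN; ring.
Qed.

Lemma Im_fourier_coef f (m : int) : L2 f -> Im (fourier_coef f m) =
  \int[mu]_(x in I01) (Im (f x) * cos_tau (m%:~R * x)) -
  \int[mu]_(x in I01) (Re (f x) * sin_tau (m%:~R * x)).
Proof.
move=> Lf; have [ir ii] := (L2_Re Lf, L2_Im Lf).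
rewrite -mulN1r -(Rint01Z _ (int01Msin _ ir)).
rewrite -(Rint01D (int01Mcos _ ii) (int01Z _ (int01Msin _ ir))).
by apply: eq_Rintegral => x _; rewrite ImM Re_expi Im_expi mulrNz mulNr cos_tauN sin_tauN; ring.
Qed.

(** Sums and differences of the coefficients at [m] and [- m] isolate the cosine and sine integrals
    of [Re f] and of [Im f], so the real completeness result applies to each part. *)
Lemma fourier_coef_eq0 f : L2 f -> (forall m, fourier_coef f m = 0) ->
  {ae mu, forall x, I01 x -> f x = 0}.
Proof.
move=> Lf f0; have [ir ii] := (L2_Re Lf, L2_Im Lf).
have key (m : int) : [/\ \int[mu]_(x in I01) (Re (f x) * cos_tau (m%:~R * x)) = 0,
   \int[mu]_(x in I01) (Re (f x) * sin_tau (m%:~R * x)) = 0,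
   \int[mu]_(x in I01) (Im (f x) * cos_tau (m%:~R * x)) = 0 &
   \int[mu]_(x in I01) (Im (f x) * sin_tau (m%:~R * x)) = 0].
  have : [/\ Re (fourier_coef f m) = 0, Re (fourier_coef f (- m)) = 0, Im (fourier_coef f m) = 0 &
    Im (fourier_coef f (- m)) = 0] by rewrite !f0.
  rewrite !Re_fourier_coef// !Im_fourier_coef//.
  have sN (h : R -> R) : int01 h -> \int[mu]_(x in I01) (h x * sin_tau ((- m)%:~R * x)) =
      - \int[mu]_(x in I01) (h x * sin_tau (m%:~R * x)).
    move=> ih; rewrite -[RHS]mulN1r -(Rint01Z _ (int01Msin _ ih)).
    by apply: eq_Rintegral => x _; rewrite mulrNz mulNr sin_tauN; ring.
  have cN (h : R -> R) : \int[mu]_(x in I01) (h x * cos_tau ((- m)%:~R * x)) =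
      \int[mu]_(x in I01) (h x * cos_tau (m%:~R * x)).
    by apply: eq_Rintegral => x _; rewrite mulrNz mulNr cos_tauN.
  by rewrite !sN// !cN; set A := Rintegral _ _ _; set B := Rintegral _ _ _;
    set D := Rintegral _ _ _; set E := Rintegral _ _ _ => -[e1 e2 e3 e4]; split; lra.
have Ore : trig_orthogonal (fun x => Re (f x)).
  by split => // m; have [] := key m.
have Oim : trig_orthogonal (fun x => Im (f x)).
  by split => // m; have [] := key m.
move: (trig_orthogonal_eq0 Ore) (trig_orthogonal_eq0 Oim).
apply: filterS2; first exact: (ae_filter_ringOfSetsType mu).
by move=> x re0 im0 Ix; apply: eq_ReIm; rewrite ?re0 ?im0.
Qed.

Lemma L2_coef_inj f g : L2 f -> L2 g -> fourier_coef f =1 fourier_coef g ->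
  {ae mu, forall x, I01 x -> f x = g x}.
Proof.
move=> Lf Lg fg; have : {ae mu, forall x, I01 x -> f x - g x = 0}.
  by apply: fourier_coef_eq0; [exact: L2B|move=> m; rewrite fourier_coefB// fg subrr].
apply: filterS; first exact: (ae_filter_ringOfSetsType mu).
by move=> x h Ix; apply/eqP; rewrite -subr_eq0; apply/eqP/h.
Qed.

(** Against Bessel: Riesz-Fischer rebuilds from the coefficients of [f] a function of norm at most
    [ell2sq], and completeness identifies it with [f] almost everywhere. *)
Theorem parseval f : L2 f -> sqnorm01 f = ell2sq (fourier_coef f).
Proof.
move=> Lf; apply/eqP; rewrite eq_le bessel// andbT.
have [|g [Lg fg gle]] := @riesz_fischer (fourier_coef f).
  by apply: le_lt_trans (bessel Lf) _; case: Lf.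
apply: le_trans gle; rewrite le_eqVlt; apply/orP; left; apply/eqP.
apply: ge0_ae_eq_integral => //.
- by apply/measurable_EFinP; apply: measurable_funTS; apply: measurable_sqnormC; case: Lf.
- by apply/measurable_EFinP; apply: measurable_funTS; apply: measurable_sqnormC; case: Lg.
- by move=> x _; rewrite lee_fin sqnormC_ge0.
- by move=> x _; rewrite lee_fin sqnormC_ge0.
- have := L2_coef_inj Lf Lg (fsym fg).
  apply: filterS; first exact: (ae_filter_ringOfSetsType mu).
  by move=> x h Ix; rewrite h.
Qed.
End RieszFischer.

(** * The duality transform *)

Section CountableSums.
Context {R : realType}.
Local Notation mu := (@lebesgue_measure R).

Lemma esum_inj_le (T1 T2 : choiceType) (e : T1 -> T2) (a : T2 -> \bar R) :
  injective e -> (forall y, 0 <= a y)%E ->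
  (\esum_(i in [set: T1]) a (e i) <= \esum_(j in [set: T2]) a j)%E.
Proof.
move=> inj_e a0; rewrite -(esum_image [set: T1] e); last by move=> x y _ _; exact: inj_e.
by rewrite esum_mkcond; apply: le_esum => j _; case: ifP.
Qed.

(** Turns a sum over a countable type into a series over [nat], to which term-by-term integration
    applies; codes without a preimage contribute 0. *)
Lemma esum_pickle (T : countType) (a : T -> \bar R) : (forall k, 0 <= a k)%E ->
  (\esum_(k in [set: T]) a k = \sum_(0 <= n <oo) oapp a 0 (pickle_inv n))%E.
Proof.
move=> a0; pose g n := oapp a 0%E (@pickle_inv T n).
have g0 n : (0 <= g n)%E by rewrite /g; case: pickle_inv => /=.
rewrite nneseries_esumT//.
transitivity (\esum_(k in [set: T]) g (pickle k))%E.
  by apply: eq_esum => k _; rewrite /g pickleK_inv.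
rewrite -(esum_image [set: T] (@pickle T)); last first.
  by move=> x y _ _; exact: (pcan_inj (@pickleK_inv T)).
rewrite esum_mkcond; apply: eq_esum => n _; case: ifPn => // nT.
rewrite /g; case E : (pickle_inv n) => [k|//]; case/negP: nT.
by rewrite inE; exists k => //; have := @pickle_invK T n; rewrite E.
Qed.

Lemma ge0_integral_esum (T : countType) (a : T -> R -> \bar R) (D : set R) :
  measurable D -> (forall k, measurable_fun D (a k)) -> (forall k x, 0 <= a k x)%E ->
  (\int[mu]_(x in D) (\esum_(k in [set: T]) a k x) =
   \esum_(k in [set: T]) \int[mu]_(x in D) a k x)%E.
Proof.
move=> mD ma a0; rewrite esum_pickle; last by move=> k; apply: integral_ge0.
under eq_integral do rewrite esum_pickle//.
rewrite integral_nneseries//.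
- apply: eq_eseriesr => n _; case: pickle_inv => //=.
  by rewrite integral0.
- by move=> n; case: pickle_inv => [k|] /=; [exact: ma|exact: measurable_cst].
- by move=> n x _; case: pickle_inv => /=.
Qed.

Lemma esum_bool (a : bool -> \bar R) : (forall b, 0 <= a b)%E ->
  (\esum_(b in [set: bool]) a b = a true + a false)%E.
Proof.
move=> a0; rewrite (esumID [set true])// !setTI (_ : ~` [set true] = [set false]).
  by rewrite !esum_set1.
by apply/seteqP; split=> [[] /= // /(_ erefl)|_ ->].
Qed.

End CountableSums.

(** * Both operators on Fourier coefficients, and the intertwining relation *)

Section Duality.
Context {R : realType}.
Local Notation C := R[i].
Variables l1 l2 Phi : R.
Local Notation mu := (@lebesgue_measure R).
Local Notation I01 := (`[0%R, 1%R]%classic : set R).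
Implicit Types (f g : R -> C) (z w c : C) (F G : @Defs.field R) (phi psi : int -> C).
Local Notation "x %:C" := (real_complex _ x)%C.
Local Notation Q l th := (Qentry l Phi th).
Local Notation W := (dirint (fun th => Wmat l1 l2 Phi th)).
Local Notation Ws := (dirint (fun th => Wsharp_mat l1 l2 Phi th)).

(** Square-integrability travels with the coefficients, so operators can be composed on the
    coefficient side without separate integrability goals. *)
Definition has_coef f phi : Prop := L2 f /\ fourier_coef f =1 phi.

Lemma has_coefD f g phi psi : has_coef f phi -> has_coef g psi ->
  has_coef (fun x => f x + g x) (fun k => phi k + psi k).
Proof.
by move=> [Lf cf] [Lg cg]; split; [exact: L2D|move=> k; rewrite fourier_coefD// cf cg].
Qed.

Lemma has_coefZ c f phi : has_coef f phi ->
  has_coef (fun x => c * f x) (fun k => c * phi k).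
Proof.
by move=> [Lf cf]; split; [exact: L2Z|move=> k; rewrite fourier_coefZ// cf].
Qed.

Lemma has_coefN f phi : has_coef f phi -> has_coef (fun x => - f x) (fun k => - phi k).
Proof.
move=> /(has_coefZ (-1)).
by congr has_coef; apply/funext => x; rewrite mulN1r.
Qed.

Lemma has_coefB f g phi psi : has_coef f phi -> has_coef g psi ->
  has_coef (fun x => f x - g x) (fun k => phi k - psi k).
Proof. by move=> Hf Hg; apply: has_coefD => //; exact: has_coefN. Qed.

Lemma has_coefMexpi (m : int) f phi : has_coef f phi ->
  has_coef (fun x => expi (m%:~R * x) * f x) (fun k => phi (k - m)).
Proof.
by move=> [Lf cf]; split; [exact: L2Mexpi|move=> k; rewrite fourier_coefMexpi cf].
Qed.

Definition phase (n : int) : C := expi (n%:~R * Phi).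

Lemma phaseD m n : phase (m + n) = phase m * phase n.
Proof. by rewrite /phase intrD mulrDl expiD. Qed.

Lemma phaseNK n : phase (- n) * phase n = 1.
Proof. by rewrite /phase mulrNz mulNr expiNK. Qed.

(** By Euler's formula this is multiplication by [cos_tau (n Phi + x)] seen on coefficients: each
    exponential shifts the index by one. In [sin_coef] the factor [- i / 2] is [1 / (2 i)]. *)
Definition cos_coef (n : int) phi : int -> C := fun k =>
  (2^-1 : C) * (phase n * phi (k - 1) + phase (- n) * phi (k + 1)).

Definition sin_coef (n : int) phi : int -> C := fun k =>
  (- ('i%C / 2) : C) * (phase n * phi (k - 1) - phase (- n) * phi (k + 1)).

Lemma sqri : 'i%C * 'i%C = -1 :> C.
Proof. by rewrite -expr2 sqr_i. Qed.

Lemma half2 : 2^-1 * 2 = 1 :> C.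
Proof. by rewrite mulVf// pnatr_eq0. Qed.

Lemma cos_expi (x : R) : Complex (cos_tau x) 0 = 2^-1 * (expi x + expi (- x)) :> C.
Proof.
have -> : expi x + expi (- x) = 2 * Complex (cos_tau x) 0.
  rewrite /expi cos_tauN sin_tauN; apply: eq_ReIm.
    by rewrite mulr_natl mulr2n /=.
  by rewrite mulr_natl mulr2n /= subrr addr0.
by rewrite mulrA half2 mul1r.
Qed.

Lemma sin_expi (x : R) : Complex (sin_tau x) 0 = - ('i%C / 2) * (expi x - expi (- x)) :> C.
Proof.
have -> : expi x - expi (- x) = 2 * ('i%C * Complex (sin_tau x) 0).
  rewrite /expi cos_tauN sin_tauN; apply: eq_ReIm.
    by rewrite mulr_natl mulr2n !(ReD, ReM, ReN) /=; ring.
  by rewrite mulr_natl mulr2n !(ImD, ImM, ImN) /=; ring.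
set z := Complex _ _; rewrite -[LHS]mul1r -[X in X * z]half2; ring: sqri half2.
Qed.

Lemma has_coefMcos (n : int) f phi : has_coef f phi ->
  has_coef (fun x => Complex (cos_tau (n%:~R * Phi + x)) 0 * f x) (cos_coef n phi).
Proof.
move=> Hf; have H1 := has_coefMexpi 1 Hf; have H2 := has_coefMexpi (-1) Hf.
have := has_coefZ 2^-1 (has_coefD (has_coefZ (phase n) H1) (has_coefZ (phase (- n)) H2)).
congr has_coef; apply/funext => x.
rewrite cos_expi opprD !expiD /phase mulrNz mulNr mulrN1z mul1r mulN1r; ring.
Qed.

Lemma has_coefMsin (n : int) f phi : has_coef f phi ->
  has_coef (fun x => Complex (sin_tau (n%:~R * Phi + x)) 0 * f x) (sin_coef n phi).
Proof.
move=> Hf; have H1 := has_coefMexpi 1 Hf; have H2 := has_coefMexpi (-1) Hf.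
have := has_coefZ (- ('i%C / 2)) (has_coefB (has_coefZ (phase n) H1) (has_coefZ (phase (- n)) H2)).
congr has_coef; apply/funext => x.
rewrite sin_expi opprD !expiD /phase mulrNz mulrN1z mul1r !mulNr mul1r; ring.
Qed.

Lemma sum_bool (h : bool -> C) : \sum_(b : bool) h b = h true + h false.
Proof. by rewrite big_bool. Qed.

Local Arguments Qentry : simpl never.

Lemma band_applyE (K : int -> bool -> int -> bool -> C) (psi : vec R) m s :
  band_apply K psi m s =
  (K m s (m - 1) true * psi (m - 1) true + K m s (m - 1) false * psi (m - 1) false) +
  (K m s m true * psi m true + K m s m false * psi m false) +
  (K m s (m + 1) true * psi (m + 1) true + K m s (m + 1) false * psi (m + 1) false).
Proof.
rewrite /band_apply !big_ord_recl big_ord0 !sum_bool.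
have -> : m + (ord0 : 'I_3)%:Z - 1 = m - 1 by rewrite /=; lia.
have -> : m + (lift ord0 (ord0 : 'I_2))%:Z - 1 = m by rewrite /= /bump /=; lia.
have -> : m + (lift ord0 (lift ord0 (ord0 : 'I_1)))%:Z - 1 = m + 1.
  by rewrite /= /bump /=; lia.
by rewrite addr0 !addrA.
Qed.

Lemma Sdelta_true (l : R) n m s : Sdelta l n true m s =
  l%:C * ((m == n + 1) && s)%:R + (lamp l)%:C * ((m == n) && ~~ s)%:R.
Proof. by rewrite /Sdelta /delta; case: s; do 2 case: (m == _). Qed.

Lemma Sdelta_false (l : R) n m s : Sdelta l n false m s =
  l%:C * ((m == n - 1) && ~~ s)%:R - (lamp l)%:C * ((m == n) && s)%:R.
Proof. by rewrite /Sdelta /delta; case: s; do 2 case: (m == _). Qed.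

Lemma int_neqs (m : int) :
  ((((m == m - 1)%R = false) * ((m == m + 1)%R = false)) *
   (((m == m - 1 - 1)%R = false) * ((m == m + 1 + 1)%R = false)) *
   (((m - 1 == m)%R = false) * ((m + 1 == m)%R = false)) *
   (((m - 1 == m + 1)%R = false) * ((m + 1 == m - 1)%R = false)))%type.
Proof. by do !split; apply/negbTE/eqP; lia. Qed.

(** Only [delta_(m-1)^+] and [delta_m^-] have an image under the shift-coin operator with a
    component on [delta_m^+]; the other neighbours drop out. *)
Lemma W_plus F th m : W F th m true =
  l1%:C * (Q l2 th (m - 1) true true * F th (m - 1) true +
           Q l2 th (m - 1) true false * F th (m - 1) false) -
  (lamp l1)%:C * (Q l2 th m false true * F th m true + Q l2 th m false false * F th m false).
Proof.
rewrite /dirint band_applyE /Wmat /Wdelta !sum_bool !Sdelta_true !Sdelta_false.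
by rewrite !subrK !addrK !int_neqs !eqxx /=; ring.
Qed.

Lemma W_minus F th m : W F th m false =
  l1%:C * (Q l2 th (m + 1) false true * F th (m + 1) true +
           Q l2 th (m + 1) false false * F th (m + 1) false) +
  (lamp l1)%:C * (Q l2 th m true true * F th m true + Q l2 th m true false * F th m false).
Proof.
rewrite /dirint band_applyE /Wmat /Wdelta !sum_bool !Sdelta_true !Sdelta_false.
by rewrite !subrK !addrK !int_neqs !eqxx /=; ring.
Qed.

(** Transposing [S_l2 Q_l1] gives [Q_l1^T S_l2^T]: the columns of the shift act as rows first, then
    the transposed local matrix at site [m]. *)
Lemma WsharpE F th m s : Ws F th m s =
  Q l1 th m true s * (l2%:C * F th (m + 1) true + (lamp l2)%:C * F th m false) +
  Q l1 th m false s * (l2%:C * F th (m - 1) false - (lamp l2)%:C * F th m true).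
Proof.
rewrite /dirint band_applyE /Wsharp_mat /Wmat /Wdelta !sum_bool !Sdelta_true !Sdelta_false.
by rewrite !int_neqs !eqxx /=; ring.
Qed.

Lemma has_coefQ l n f phi s t : has_coef f phi ->
  has_coef (fun th => Q l th n s t * f th)
  (match s, t with
   | true, true => fun k => l%:C * cos_coef n phi k + (lamp l)%:C * 'i%C * phi k
   | true, false => fun k => - (l%:C * sin_coef n phi k)
   | false, true => fun k => l%:C * sin_coef n phi k
   | false, false => fun k => l%:C * cos_coef n phi k - (lamp l)%:C * 'i%C * phi k
   end).
Proof.
move=> Hf; have Hc := has_coefZ l%:C (has_coefMcos n Hf).
have Hs := has_coefZ l%:C (has_coefMsin n Hf).
have Hi := has_coefZ ((lamp l)%:C * 'i%C) Hf.
case: s t => [] [].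
- rewrite /Qentry; have := has_coefD Hc Hi; congr has_coef; apply/funext => x.
  rewrite mulrA -mulrDl; congr (_ * _).
  by apply: eq_ReIm; rewrite !(ReD, ReM, ImD, ImM) /= /cos_tau; ring.
- rewrite /Qentry; have := has_coefN Hs; congr has_coef; apply/funext => x.
  rewrite mulrA -mulNr; congr (_ * _).
  by apply: eq_ReIm; rewrite !(ReN, ReD, ReM, ImN, ImD, ImM) /= /sin_tau; ring.
- rewrite /Qentry; have := Hs; congr has_coef; apply/funext => x.
  rewrite mulrA; congr (_ * _).
  by apply: eq_ReIm; rewrite !(ReN, ReD, ReM, ImN, ImD, ImM) /= /sin_tau; ring.
- rewrite /Qentry; have := has_coefB Hc Hi; congr has_coef; apply/funext => x.
  rewrite mulrA -mulrBl; congr (_ * _).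
  by apply: eq_ReIm; rewrite !(ReD, ReM, ReN, ImN, ImD, ImM) /= /cos_tau; ring.
Qed.

Definition fcoef F (m n : int) (t : bool) : C := fourier_coef (fun th => F th n t) m.

Definition componentL2 F := forall n s, L2 (fun th => F th n s).

Definition isqrt2 : C := ((Num.sqrt 2)^-1)%:C.

(* [mix] is the matrix [M^*] and [unmix] the matrix [M]. *)
Definition mix (z : bool -> C) (s : bool) : C := isqrt2 * (z s + 'i%C * z (~~ s)).

(* The graph of the duality unitary, read on Fourier coefficients. *)
Definition dual F G := forall j s, has_coef (fun th => G th j s)
  (fun k => phase (j * k) * mix (fcoef F (- j) k) s).

Lemma has_coef_fcoef F n s : componentL2 F ->
  has_coef (fun th => F th n s) (fun m => fcoef F m n s).
Proof. by move=> LF; split => //; exact: LF. Qed.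

Lemma has_coef_W_plus F n (LF : componentL2 F) :
  has_coef (fun th => W F th n true)
  (fun k => l1%:C * ((l2%:C * cos_coef (n - 1) (fun m => fcoef F m (n - 1) true) k +
                      (lamp l2)%:C * 'i%C * fcoef F k (n - 1) true) +
                     - (l2%:C * sin_coef (n - 1) (fun m => fcoef F m (n - 1) false) k)) -
    (lamp l1)%:C * (l2%:C * sin_coef n (fun m => fcoef F m n true) k +
       (l2%:C * cos_coef n (fun m => fcoef F m n false) k -
        (lamp l2)%:C * 'i%C * fcoef F k n false))).
Proof.
under eq_fun do rewrite W_plus.
have H n' t s := has_coefQ l2 n' s t (has_coef_fcoef n' t LF).
exact: (has_coefB (has_coefZ _ (has_coefD (H (n - 1) true true) (H (n - 1) false true)))
  (has_coefZ _ (has_coefD (H n true false) (H n false false)))).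
Qed.

Lemma has_coef_W_minus F n (LF : componentL2 F) :
  has_coef (fun th => W F th n false)
  (fun k => l1%:C * (l2%:C * sin_coef (n + 1) (fun m => fcoef F m (n + 1) true) k +
       (l2%:C * cos_coef (n + 1) (fun m => fcoef F m (n + 1) false) k -
        (lamp l2)%:C * 'i%C * fcoef F k (n + 1) false)) +
    (lamp l1)%:C * ((l2%:C * cos_coef n (fun m => fcoef F m n true) k +
                      (lamp l2)%:C * 'i%C * fcoef F k n true) +
                     - (l2%:C * sin_coef n (fun m => fcoef F m n false) k))).
Proof.
under eq_fun do rewrite W_minus.
have H n' t s := has_coefQ l2 n' s t (has_coef_fcoef n' t LF).
exact: (has_coefD (has_coefZ _ (has_coefD (H (n + 1) true false) (H (n + 1) false false)))
  (has_coefZ _ (has_coefD (H n true true) (H n false true)))).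
Qed.

(** The twist is a bicharacter of [(j, k)]. A unit shift of one index costs a phase in the other,
    which is the commutation relation between shifts and exponentials. *)
Lemma phase_mulDD (j k a b : int) : phase ((j + a) * (k + b)) =
  phase (j * k) * phase (j * b) * phase (a * k) * phase (a * b).
Proof. by rewrite -!phaseD; congr phase; ring. Qed.

(** Frequency [- j] and site [k] of [F] become site [j] and frequency [k] of [G], so site shifts
    turn into multiplications by exponentials and conversely. The twist absorbs the phases and [mix]
    diagonalises the rotations; comparing coefficients leaves an algebraic identity. *)
Lemma dual_intertwines F G : componentL2 F -> dual F G -> dual (W F) (Ws G).
Proof.
move=> LF FG j s.
under eq_fun do rewrite WsharpE.
have := has_coefD
  (has_coefQ l1 j true s (has_coefD (has_coefZ l2%:C (FG (j + 1) true))
     (has_coefZ (lamp l2)%:C (FG j false))))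
  (has_coefQ l1 j false s (has_coefB (has_coefZ l2%:C (FG (j - 1) false))
     (has_coefZ (lamp l2)%:C (FG j true)))).
congr has_coef; apply/funext => k.
have [_ Wp] := has_coef_W_plus k LF; have [_ Wm] := has_coef_W_minus k LF.
(* Adding an explicit 0 puts shifts of either index in the shape of [phase_mulDD]. *)
have Ek (x : int) : j * (k + x) = (j + 0) * (k + x) by rewrite addr0.
have Ej (x : int) : (j + x) * k = (j + x) * (k + 0) by rewrite addr0.
rewrite /mix.
have jj := phaseNK j.
have e1 : - (j + 1) = - j - 1 by rewrite opprD.
have e2 : - (j - 1) = - j + 1 by rewrite opprB addrC.
have Wp' : fcoef (W F) (- j) k true = _ := Wp (- j).
have Wm' : fcoef (W F) (- j) k false = _ := Wm (- j).
have e3 : - (k - 1) = - k + 1 by rewrite opprB addrC.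
have e4 : - (k + 1) = - k - 1 by rewrite opprD.
rewrite /cos_coef /sin_coef ?e3 ?e4 !phaseD in Wp' Wm'.
have ii := sqri.
have F0 : phase 0 = 1 by rewrite /phase mul0r expi0.
case: s => /=; rewrite Wp' Wm' /cos_coef /sin_coef !Ek !Ej -/phase !phase_mulDD !e1 !e2
   !(mulrN, mulr1, mul1r, mulN1r, mul0r, mulr0, opprK) ?F0
   -[(1 * 1)%N]/1%N.
(* With coefficients and phases abstracted, the identity follows from [phase (- j) * phase j = 1]
   and [i^2 = -1]. *)
- move: (fcoef F) (phase (j * k)) (phase j) (phase (- j)) (phase k) (phase (- k))
    (phase 1) (phase (-1)) jj {Wp Wm Wp' Wm' Ek Ej F0 e1 e2 e3 e4} => c pjk pj pj' pk pk' p1 p1' jj.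
  by move: isqrt2 => rt; field: jj ii.
- move: (fcoef F) (phase (j * k)) (phase j) (phase (- j)) (phase k) (phase (- k))
    (phase 1) (phase (-1)) jj {Wp Wm Wp' Wm' Ek Ej F0 e1 e2 e3 e4} => c pjk pj pj' pk pk' p1 p1' jj.
  by move: isqrt2 => rt; field: jj ii.
Qed.

(** * Norm preservation, and existence of duals and preduals *)

Lemma L2norm2_components F : (forall n s, cmeasurable (fun th => F th n s)) ->
  L2norm2 F = (\esum_(p in [set: int * bool]) sqnorm01 (fun th => F th p.1 p.2))%E.
Proof.
move=> mF; rewrite /L2norm2 ge0_integral_esum//.
  by move=> p; apply/measurable_EFinP; apply: measurable_funTS; exact: measurable_sqnormC.
by move=> p x; rewrite lee_fin sqnormC_ge0.
Qed.

Lemma in_L2_component F : in_L2 F -> componentL2 F.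
Proof.
move=> [mF nF] n s; split; first exact: mF.
apply: le_lt_trans nF; rewrite L2norm2_components; last by move=> n' s'; exact: mF.
apply: esum_ge; exists [set (n, s)]; first by split => //; exact: finite_set1.
by rewrite fsbig_set1.
Qed.

(** The two spin components are grouped because [mix] preserves the sum of their squares, not each
    square. *)
Definition energy F (m n : int) : R :=
  sqnormC (fcoef F m n true) + sqnormC (fcoef F m n false).

Lemma energy_ge0 F m n : 0 <= energy F m n.
Proof. by rewrite addr_ge0// sqnormC_ge0. Qed.

(** Parseval in every component, followed by regrouping the nonnegative sum over site, spin and
    frequency with the spin innermost. *)
Lemma L2norm2_energy F : componentL2 F ->
  L2norm2 F = (\esum_(q in [set: int * int]) (energy F q.1 q.2)%:E)%E.
Proof.
move=> LF; rewrite L2norm2_components; last by move=> n s; case: (LF n s).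
pose b (q : int * int) (s : bool) := (sqnormC (fcoef F q.1 q.2 s))%:E.
transitivity (\esum_(q in [set: int * int]) \esum_(s in [set: bool]) b q s)%E; last first.
  apply: eq_esum => q _; rewrite esum_bool// => s; rewrite lee_fin; exact: sqnormC_ge0.
under eq_esum do rewrite parseval// /ell2sq.
rewrite !esum_esum; try by move=> *; rewrite lee_fin sqnormC_ge0.
have XT (T1 T2 : Type) : [set: T1] `*`` (fun=> [set: T2]) = [set: T1 * T2].
  by apply/seteqP; split.
rewrite !XT (@reindex_esum _ _ _ [set: (int * int) * bool] _
  (fun x => ((x.1.2, x.2), x.1.1)))//.
rewrite setTT_bijective; exists (fun y => ((y.2, y.1.1), y.1.2)).
  by move=> [[? ?] ?].
by move=> [[? ?] ?].
Qed.

Lemma sqnorm_isqrt2 : sqnormC (isqrt2 : C) = 2^-1.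
Proof. by rewrite sqnormCE /= expr0n addr0 exprVn sqr_sqrtr. Qed.

Lemma mix_energy (z : bool -> C) :
  sqnormC (mix z true) + sqnormC (mix z false) = sqnormC (z true) + sqnormC (z false).
Proof.
rewrite /mix !sqnormCM sqnorm_isqrt2 !sqnormCE !(ReD, ImD, ReM, ImM) /=; by field.
Qed.

Definition unmix (z : bool -> C) (s : bool) : C := isqrt2 * (z s - 'i%C * z (~~ s)).

Lemma unmix_energy (z : bool -> C) :
  sqnormC (unmix z true) + sqnormC (unmix z false) = sqnormC (z true) + sqnormC (z false).
Proof.
rewrite /unmix !sqnormCM sqnorm_isqrt2 !sqnormCE !(ReN, ImN, ReD, ImD, ReM, ImM) /=; by field.
Qed.

Lemma isqrt2_sqr : isqrt2 * isqrt2 = 2^-1 :> C.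
Proof.
have h : (Num.sqrt 2)^-1 * (Num.sqrt 2)^-1 = 2^-1 :> R.
  by rewrite -expr2 exprVn sqr_sqrtr.
have -> : 2^-1 = (2^-1 : R)%:C by rewrite fmorphV rmorph_nat.
by rewrite /isqrt2 -rmorphM h.
Qed.

Lemma mixK (z : bool -> C) s : mix (unmix z) s = z s.
Proof.
rewrite /mix /unmix negbK; transitivity (isqrt2 * isqrt2 * 2 * z s).
  2: by rewrite isqrt2_sqr half2 mul1r.
by have := sqri; move: isqrt2 => r ii; ring: ii.
Qed.

Lemma dual_componentL2 F G : dual F G -> componentL2 G.
Proof. by move=> FG n s; have [] := FG n s. Qed.

(** The twist has modulus one and [mix] is unitary. Since the relabelling of the lattice is
    bijective, total energy is preserved as well. *)
Lemma dual_energy F G k j : dual F G -> energy G k j = energy F (- j) k.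
Proof.
move=> FG; rewrite /energy -[RHS]mix_energy.
by rewrite /fcoef !(FG j _).2 !sqnormCM sqnormC_expi !mul1r.
Qed.

Lemma dual_norm F G : componentL2 F -> dual F G -> L2norm2 G = L2norm2 F.
Proof.
move=> LF FG; rewrite !L2norm2_energy//; last exact: dual_componentL2 FG.
rewrite (@reindex_esum _ _ _ [set: int * int] [set: int * int] (fun q => (q.2, - q.1))).
  by apply: eq_esum => q _; rewrite (dual_energy _ _ FG) /= opprK; case: q.
rewrite setTT_bijective; by exists (fun q => (- q.2, q.1)) => -[? ?] /=; rewrite opprK.
Qed.

Lemma exists_has_coef (c : int -> bool -> int -> C) :
  (forall n s, ell2sq (c n s) < +oo)%E ->
  exists F, forall n s, has_coef (fun th => F th n s) (c n s).
Proof.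
move=> c_fin.
have /choice[h Hh] : forall p : int * bool, exists f, has_coef f (c p.1 p.2).
  move=> p; have [f [Lf cf _]] := riesz_fischer (c_fin p.1 p.2).
  by exists f; split.
by exists (fun th n s => h (n, s) th) => n s; exact: (Hh (n, s)).
Qed.

(** A sequence dominated by the energies along an injective path in the frequency-site lattice is
    square-summable, since the energies over the whole lattice sum to the norm of [F]. *)
Lemma ell2sq_energy F (e : int -> int * int) (a : int -> C) : in_L2 F ->
  injective e -> (forall k, sqnormC (a k) <= energy F (e k).1 (e k).2) ->
  (ell2sq a < +oo)%E.
Proof.
move=> LF inj_e ae; have [_ nF] := LF; apply: le_lt_trans nF.
rewrite L2norm2_energy; last exact: in_L2_component.
apply: le_trans (@esum_inj_le _ _ _ e (fun q => (energy F q.1 q.2)%:E) inj_e _); last first.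
  by move=> q; rewrite lee_fin energy_ge0.
by apply: le_esum => k _; rewrite lee_fin.
Qed.

Lemma le_energy (y : bool -> C) s x : sqnormC (y true) + sqnormC (y false) = x ->
  sqnormC (y s) <= x.
Proof.
by move=> <-; case: s; rewrite ?lerDl ?lerDr sqnormC_ge0.
Qed.

Lemma exists_dual F : in_L2 F -> exists G, dual F G.
Proof.
move=> LF; apply: exists_has_coef => j s.
apply: (@ell2sq_energy F (fun k => (- j, k))) => //; first by move=> ? ? [].
move=> k; rewrite sqnormCM sqnormC_expi mul1r /=.
apply: (@le_energy (mix (fcoef F (- j) k))); exact: mix_energy.
Qed.

Lemma exists_predual G : in_L2 G -> exists2 F, in_L2 F & dual F G.
Proof.
move=> LG; have cG := in_L2_component LG.
(* The duality relation solved for [F]: with [m = - j] and [n = k], the inverse of [phase (j * k)]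
   is [phase (m * n)], and [unmix] is the inverse of [mix]. *)
have [|F HF] := @exists_has_coef
    (fun n s m => phase (m * n) * unmix (fcoef G n (- m)) s).
  move=> n s; apply: (@ell2sq_energy G (fun m => (n, - m))) => //.
    by move=> x y [] /oppr_inj.
  move=> m; rewrite sqnormCM sqnormC_expi mul1r /=.
  by apply: (@le_energy (unmix (fcoef G n (- m)))); exact: unmix_energy.
have cF : componentL2 F by move=> n s; have [] := HF n s.
have FG : dual F G.
  move=> j s; split; first exact: cG.
  move=> k; rewrite (_ : fcoef F (- j) k =
      fun t => phase (- (j * k)) * unmix (fcoef G k j) t); last first.
    by apply/funext => t; rewrite /fcoef (HF k t).2 opprK mulNr.
  rewrite -[LHS]/(fcoef G k j s) -[LHS](mixK (fcoef G k j)) /mix.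
  by have := phaseNK (j * k) => e; ring: e.
exists F => //; split; first by move=> n s; have [[]] := cF n s.
by rewrite -(dual_norm cF FG); case: LG.
Qed.

(** * Compatibility with almost-everywhere classes *)

Lemma fourier_coef_ae_eq f g m : L2 f -> L2 g -> {ae mu, forall x, I01 x -> f x = g x} ->
  fourier_coef f m = fourier_coef g m.
Proof.
move=> Lf Lg fg; have LB := L2B Lf Lg.
apply/eqP; rewrite -subr_eq0 -fourier_coefB//; apply/eqP/sqnormC_eq0/eqP.
(* Bessel for one mode bounds the coefficient of [f - g] by the squared norm of [f - g], which is
   zero. *)
rewrite eq_le sqnormC_ge0 andbT; apply: le_trans (sqnormC_coef_le m LB) _.
rewrite -lee_fin -sqnorm01E// /sqnorm01 (@ge0_ae_eq_integral _ _ _ mu _ _ (cst 0%E)) //.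
- by rewrite integral_cst// mul0e.
- by apply/measurable_EFinP; apply: measurable_funTS; apply: measurable_sqnormC; case: LB.
- by move=> x _; rewrite lee_fin sqnormC_ge0.
- move: fg; apply: filterS; first exact: (ae_filter_ringOfSetsType mu).
  by move=> x h Ix; rewrite h// subrr sqnormC0.
Qed.

Lemma fcoef_ae_eq F G : componentL2 F -> componentL2 G -> Defs.ae_eq F G ->
  fcoef F = fcoef G.
Proof.
move=> LF LG FG; apply/funext => m; apply/funext => n; apply/funext => t.
apply: (fourier_coef_ae_eq m (LF n t) (LG n t)).
apply: negligibleS FG => x /= /not_implyP[]; rewrite in_itv/= => Ix FGx.
by split => // e; apply: FGx; rewrite e.
Qed.

(** There are countably many components, so the union of their exceptional sets is still negligible;
    codes of no component give the empty set. *)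
Lemma field_ae_eq F G :
  (forall n s, {ae mu, forall x, I01 x -> F x n s = G x n s}) -> Defs.ae_eq F G.
Proof.
move=> FG.
pose N (i : nat) : set R := if pickle_inv i is Some (n, s)
  then ~` [set x | I01 x -> F x n s = G x n s] else set0.
have negN i : mu.-negligible (N i).
  rewrite /N; case: pickle_inv => [[n s]|]; [exact: FG|exact: negligible_set0].
apply: negligibleS (negligible_bigcup negN) => x /= [Ix FGx].
have [[n s] ns] : exists p : int * bool, F x p.1 p.2 <> G x p.1 p.2.
  apply: contrapT => /forallNP h; apply: FGx; apply/funext => n; apply/funext => s.
  by have /contrapT := h (n, s).
exists (pickle (n, s)) => //; rewrite /N pickleK_inv /= => h; apply: ns; apply: h.
by rewrite in_itv.
Qed.

Lemma dual_unique F G G' : dual F G -> dual F G' -> Defs.ae_eq G G'.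
Proof.
move=> FG FG'; apply: field_ae_eq => n s.
have [Lf c1] := FG n s; have [Lg c2] := FG' n s.
by apply: L2_coef_inj => // k; rewrite c1 c2.
Qed.

Lemma dual_lin (a : C) F F' G G' : componentL2 F -> componentL2 F' ->
  dual F G -> dual F' G' ->
  dual (fun th n s => a * F th n s + F' th n s) (fun th n s => a * G th n s + G' th n s).
Proof.
move=> LF LF' FG FG' j s.
have := has_coefD (has_coefZ a (FG j s)) (FG' j s); congr has_coef.
apply/funext => k; rewrite /mix /fcoef !fourier_coefD ?fourier_coefZ//; try exact: L2Z; ring.
Qed.
End Duality.

Theorem theorem2p3 (R : realType) (l1 l2 Phi : R) :
  0 <= l1 <= 1 -> 0 <= l2 <= 1 ->
  unitarily_equivalent (dirint (fun th => Wmat l1 l2 Phi th))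
                       (dirint (fun th => Wsharp_mat l1 l2 Phi th)).
Proof.
move=> _ _.
(* Choice turns the duality relation into a function on all fields, with the dummy value [F] where
   no dual exists. *)
have /choice[U HU] : forall F : @Defs.field R, exists G,
    (exists G', dual Phi F G') -> dual Phi F G.
  move=> F; have [[G FG]|noG] := pselect (exists G, dual Phi F G); first by exists G.
  by exists F => /noG.
have dU F : in_L2 F -> dual Phi F (U F) by move=> /(exists_dual Phi)/HU.
have nU F : in_L2 F -> L2norm2 (U F) = L2norm2 F.
  by move=> LF; apply: (dual_norm (in_L2_component LF) (dU _ LF)).
exists U; split.
- split=> [F LF|F G LF LG FG].
    split; last by rewrite nU//; case: LF.
    by move=> n s; have [[]] := dU _ LF n s.
  (* Being a dual depends on the source only through its coefficients, so [U G] is a dual of [F]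
     too. *)
  apply: (@dual_unique _ Phi F); first exact: dU.
  rewrite /dual (fcoef_ae_eq (in_L2_component LF) (in_L2_component LG) FG).
  exact: dU.
- move=> a F G LF LG.
  have H := dual_lin a (in_L2_component LF) (in_L2_component LG) (dU _ LF) (dU _ LG).
  exact: dual_unique (HU _ (ex_intro _ _ H)) H.
- exact: nU.
- move=> G LG; have [F LF FG] := exists_predual Phi LG.
  by exists F => //; apply: dual_unique FG; exact: dU.
(* The intertwining lemma exhibits a dual of the image of [F]; hence the value chosen by [U] is also
   one, and uniqueness compares the two. *)
- move=> F LF; have H := dual_intertwines l1 l2 (in_L2_component LF) (dU _ LF).
  exact: dual_unique (HU _ (ex_intro _ _ H)) H.
Qed.
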